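(* For any $a\in\mathcal{S}$, there exists a bounded linear operator on $\ell^1(\mathbb{N})$ which is chaotic and which is not $\mathcal{U}$-frequently hypercyclic with respect to $a$.
   Context: $\mathbb{N}=\{0,1,2,\dots\}$; $\ell^1(\mathbb{N})$ is the usual Banach space of absolutely summable complex sequences. For a non-decreasing sequence $a=(a_n)_{n\in\mathbb{N}}$ of non-negative real numbers put $v_n(a)=\dfrac{a_n}{\sum_{j=0}^{n-1}a_j}$, considered only for those $n$ with $\sum_{j=0}^{n-1}a_j>0$. The class $\mathcal{S}$ is the set of all sequences $a=(a_n)_{n\in\mathbb{N}}$ of non-negative reals such that $(a_n)$ is non-decreasing, $a_n\to+\infty$, $(v_n(a))$ is non-increasing and $v_n(a)\to 0$. For $A\subseteq\mathbb{N}$ and $a\in\mathcal S$, the upper $a$-density is $\overline{d}_a(A)=\limsup_{N\to+\infty}\frac{\sum_{j=0}^{N}a_j\mathbf{1}_A(j)}{\sum_{j=0}^{N}a_j}$, where $\mathbf 1_A$ is the indicator function of $A$. Let $T$ be a bounded operator on a Banach space $X$. $T$ is hypercyclic if there is $x\in X$ such that $\{T^nx:n\in\mathbb{N}\}$ is dense in $X$. $T$ is chaotic if it is hypercyclic and has a dense set of periodic points. $T$ is $\mathcal{U}$-frequently hypercyclic with respect to $a$ if there is $x\in X$ such that $\overline{d}_a(\{n\in\mathbb{N}:T^nx\in U\})>0$ for every non-empty open set $U\subseteq X$. *)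

(* Defs.v *)
From HB Require Import structures.
From mathcomp Require Import all_boot all_order all_algebra.
From mathcomp Require Import all_classical all_reals all_analysis.
From mathcomp Require Import complex.

Set Implicit Arguments.
Unset Strict Implicit.
Unset Printing Implicit Defensive.

Import Order.TTheory GRing.Theory Num.Theory.
Import numFieldNormedType.Exports.
Import ComplexField.Normc.

Local Open Scope classical_set_scope.
Local Open Scope ring_scope.
Local Open Scope complex_scope.

Section ell1.
Variable R : realType.

Definition abs_summable (x : nat -> R[i]) : Prop :=
  cvgn (series (fun n => normc (x n))).

(* [R[i]^o] is [R[i]] seen as a module over itself, so that sequences form a
   module over [R[i]] under the pointwise operations. *)
Definition ell1_pred : {pred nat -> R[i]^o} := fun x => `[< abs_summable x >].

Record ell1 : Type :=
  Ell1 { ell1_seq :> nat -> R[i]^o; _ : ell1_seq \in ell1_pred }.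

HB.instance Definition _ := [isSub for ell1_seq].
HB.instance Definition _ := [Choice of ell1 by <:].

Lemma abs_summableP (x : ell1) : cvgn (series (fun n => normc (x n))).
Proof. by case: x => x /= /asboolP. Qed.
Arguments abs_summableP : clear implicits.

Lemma normc_ge0 (z : R[i]) : 0 <= normc z.
Proof. by case: z => a b; exact: sqrtr_ge0. Qed.

Lemma ell1_pred_submod : GRing.submod_closed ell1_pred.
Proof.
split.
  apply/asboolP; rewrite /abs_summable.
  under [X in series X]eq_fun do rewrite normc0.
  apply/cvg_ex; exists 0; apply: (@cvg_trans _ (cst 0 @ \oo)); last exact: cvg_cst.
  apply: near_eq_cvg; apply: nearW => n.
  by rewrite /series/= big1.
move=> a x y /asboolP sx /asboolP sy; apply/asboolP.
apply: (@series_le_cvg _ _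
  (normc a *: (fun n => normc (x n)) + (fun n => normc (y n)))).
- by move=> n; exact: normc_ge0.
- by move=> n; apply: addr_ge0; [apply: mulr_ge0|]; exact: normc_ge0.
- by move=> n; apply: (le_trans (le_normcD _ _)); rewrite lerD2r normcM.
- by apply: is_cvg_seriesD => //; exact: is_cvg_seriesZ.
Qed.

HB.instance Definition _ :=
  GRing.isSubmodClosed.Build R[i] (nat -> R[i]^o) ell1_pred ell1_pred_submod.
HB.instance Definition _ := [SubChoice_isSubLmodule of ell1 by <:].

(* The norm of a [normedModType R[i]] takes its values in [R[i]], hence the
   embedding of the real number \sum_n |x n|. *)
Definition ell1_norm (x : ell1) : R[i] :=
  (limn (series (fun n => normc (x n))))%:C.

Lemma ell1_normD (x y : ell1) :
  ell1_norm (x + y) <= ell1_norm x + ell1_norm y.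
Proof.
have sx := abs_summableP x; have sy := abs_summableP y.
rewrite /ell1_norm -rmorphD lecR -(lim_seriesD sx sy).
by apply: (lim_series_le (abs_summableP (x + y)) (is_cvg_seriesD sx sy)) => n;
  exact: le_normcD.
Qed.

Lemma ell1_normZ (l : R[i]) (x : ell1) :
  ell1_norm (l *: x) = `|l| * ell1_norm x.
Proof.
have -> : `|l| = (normc l)%:C by case: l.
rewrite /ell1_norm -rmorphM; congr (_%:C).
rewrite -[RHS](lim_seriesZ (normc l) (abs_summableP x)).
congr (limn (series _)); apply/funext => n.
exact: normcM.
Qed.

Lemma normc_le_ell1_norm (x : ell1) n :
  normc (x n) <= limn (series (fun n => normc (x n))).
Proof.
apply: (@le_trans _ _ (series (fun n => normc (x n)) n.+1)).
  rewrite /series/= big_nat_recr//= lerDr; apply: sumr_ge0 => i _.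
  exact: normc_ge0.
apply: nondecreasing_cvgn_le; last exact: abs_summableP.
by apply: nondecreasing_series => i _ _; exact: normc_ge0.
Qed.

Lemma ell1_norm0_eq0 (x : ell1) : ell1_norm x = 0 -> x = 0.
Proof.
move=> [x0]; apply/val_inj/funext => n.
apply: eq0_normc; apply/eqP; rewrite eq_le normc_ge0 andbT -x0.
exact: normc_le_ell1_norm.
Qed.

HB.instance Definition _ := Lmodule_isNormed.Build R[i] ell1
  ell1_normD ell1_normZ ell1_norm0_eq0.

Lemma normc_le_ReIm (z : R[i]) : normc z <= `|complex.Re z| + `|complex.Im z|.
Proof.
case: z => x y /=; have xy0 : 0 <= `|x| + `|y| by rewrite addr_ge0.
rewrite -[leRHS](ger0_norm xy0) -sqrtr_sqr ler_wsqrtr//.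
rewrite sqrrD !real_normK ?num_real// addrAC lerDl.
by rewrite mulrn_wge0// mulr_ge0.
Qed.

Lemma normc_ge_ReIm (z : R[i]) : (`|complex.Re z| <= normc z) /\ (`|complex.Im z| <= normc z).
Proof.
by case: z => x y /=; rewrite -!sqrtr_sqr !ler_wsqrtr ?lerDl ?lerDr ?sqr_ge0.
Qed.

Lemma ell1_complete (F : set_system (ell1)) :
  ProperFilter F -> cauchy F -> cvg F.
Proof.
move=> FF /cauchy_ballP Fc.
have {}Fc (e : R) : 0 < e -> exists2 A, F A & forall x y, A x -> A y ->
    limn (series (fun n => normc ((x - y) n))) < e.
  move=> e0; have e0' : 0 < e%:C by rewrite ltcR.
  have [[A B] /= [FA FB] AB] := Fc _ e0'.
  exists (A `&` B); first exact: filterI.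
  move=> x y [Ax _] [_ By]; rewrite -ltcR.
  by have := AB (x, y) (conj Ax By); rewrite -ball_normE.
have lim_coord (p : R[i] -> R) : (forall z, `|p z| <= normc z) ->
    (forall z z', p (z - z') = p z - p z') ->
    exists l : nat -> R, forall n e, 0 < e -> F [set x : ell1 | `|p (x n) - l n| < e].
  move=> pz pB.
  have H n : cvg ((fun x : ell1 => p (x n)) @ F).
    apply: R_complete; apply/cauchy_ballP => e e0.
    have [A FA xyA] := Fc _ e0.
    have FpA : ((fun x : ell1 => p (x n)) @ F) [set p (x n) | x in A].
      by apply: (@filterS _ F _ A _ _ FA) => x Ax; exists x.
    exists ([set p (x n) | x in A], [set p (x n) | x in A]); first by split.
    move=> [_ _] /= [[x Ax <-] [y Ay <-]].
    rewrite -ball_normE/= -pB; apply: le_lt_trans (xyA _ _ Ax Ay).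
    by apply: (le_trans (pz _)); exact: (normc_le_ell1_norm (x - y)).
  exists (fun n => lim ((fun x : ell1 => p (x n)) @ F)) => n e e0.
  have /cvgrPdist_lt/(_ e e0) := H n.
  by apply: filterS => x; rewrite /= distrC.
have [lr Hr] := lim_coord (@complex.Re R) (fun z => (normc_ge_ReIm z).1) (fun _ _ => raddfB _ _ _).
have [li Hi] := lim_coord (@complex.Im R) (fun z => (normc_ge_ReIm z).2) (fun _ _ => raddfB _ _ _).
pose l n : R[i] := (lr n +i* li n).
have Hl n (e : R) : 0 < e -> F [set x : ell1 | normc (x n - l n) < e].
  move=> e0; have e20 : 0 < e / 2 by rewrite divr_gt0.
  near=> x; apply: (le_lt_trans (normc_le_ReIm _)).
  rewrite raddfB/= [ltRHS]splitr.
  have -> : complex.Im (x n - l n) = complex.Im (x n) - li n by case: (x n).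
  have -> : complex.Re (x n) - lr n = complex.Re (x n) - lr n by [].
  by apply: ltrD; near: x; [exact: Hr|exact: Hi].
have Hsum N (e : R) : 0 < e ->
    F [set x : ell1 | \sum_(0 <= k < N) normc (x k - l k) < e].
  elim: N e => [|N IH] e e0.
    by apply: filterS filterT => x _ /=; rewrite big_geq.
  have e20 : 0 < e / 2 by rewrite divr_gt0.
  apply: filterS2 (IH _ e20) (Hl N _ e20) => x /= h1 h2.
  by rewrite big_nat_recr//= [ltRHS]splitr ltrD.
have Hfar (e : R) : 0 < e -> exists2 A, F A & forall x N, A x ->
    \sum_(0 <= k < N) normc (x k - l k) <= e.
  move=> e0; have e20 : 0 < e / 2 by rewrite divr_gt0.
  have [A FA xyA] := Fc _ e20; exists A => // x N Ax.
  have [y [Ay yl]] := filter_ex (filterI FA (Hsum N _ e20)).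
  have xy_lt := xyA _ _ Ax Ay.
  rewrite [leRHS]splitr.
  apply: (@le_trans _ _ (\sum_(0 <= k < N) normc ((x - y) k) +
                         \sum_(0 <= k < N) normc (y k - l k))).
    rewrite -big_split/=; apply: ler_sum => k _.
    have -> : x k - l k = (x k - y k) + (y k - l k) by rewrite addrA subrK.
    exact: le_normcD.
  apply: lerD; last exact: ltW.
  apply: le_trans (ltW xy_lt).
  apply: (nondecreasing_cvgn_le _ (abs_summableP (x - y))).
  by apply: nondecreasing_series => i _ _; exact: normc_ge0.
have summ (d : nat -> R[i]) (e : R) :
    (forall N, \sum_(0 <= k < N) normc (d k) <= e) -> abs_summable d.
  move=> de; apply: nondecreasing_is_cvgn; last by exists e => _ [N _ <-]; exact: de.
  by apply: nondecreasing_series => i _ _; exact: normc_ge0.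
have l_in : (l : nat -> R[i]^o) \in ell1_pred.
  have [A FA HA] := Hfar 1 ltr01; have [x Ax] := filter_ex FA.
  have xlP : ((x : nat -> R[i]^o) - (l : nat -> R[i]^o)) \in ell1_pred.
    by apply/asboolP/(summ _ 1) => N; exact: HA.
  have -> : (l : nat -> R[i]^o) = (x : nat -> R[i]^o) - ((x : nat -> R[i]^o) - l).
    by rewrite opprB addrC subrK.
  by apply: rpredB => //; exact: (valP x).
apply/cvg_ex; exists (Ell1 l_in); apply/cvgrPdist_le => e e0.
have eE : e = (complex.Re e)%:C by apply/esym/RRe_real/gtr0_real.
have e0' : 0 < complex.Re e by rewrite -ltcR -eE.
have [A FA HA] := Hfar _ e0'.
apply: filterS FA => x Ax; rewrite distrC eE lecR.
apply: limr_le; first exact: (abs_summableP (x - Ell1 l_in)).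
by apply: nearW => N; exact: HA.
Unshelve. all: by end_near. Qed.

HB.instance Definition _ := Uniform_isComplete.Build ell1 ell1_complete.

End ell1.

Section density.
Variables (R : realType) (a : R^nat).

Definition v_seq (n : nat) : R := a n / \sum_(0 <= j < n) a j.

(* Where the partial sum vanishes, [v_seq] is 0 by the convention on division by
   zero. When a is non-decreasing and unbounded this happens for finitely many n
   only, so it does not affect the limit in [class_S]; those n are excluded
   from the monotonicity condition. *)
Definition class_S : Prop :=
  [/\ forall n, 0 <= a n,
      nondecreasing_seq a,
      a @ \oo --> +oo,
      forall m n, 0 < \sum_(0 <= j < m) a j -> (m <= n)%N ->
        v_seq n <= v_seq m
    & v_seq @ \oo --> 0].

Definition upper_density (A : set nat) : \bar R :=
  limn_esup (fun N =>
    ((\sum_(0 <= j < N.+1) a j * \1_A j) / \sum_(0 <= j < N.+1) a j)%:E).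

End density.

Section dynamics.
Variables (K : numFieldType) (X : completeNormedModType K).
Implicit Type T : X -> X.

Definition bounded_operator T : Prop :=
  linear T /\ exists M : K, forall x, `|T x| <= M * `|x|.

Definition hypercyclic T : Prop :=
  exists x, dense [set iter n T x | n in [set: nat]].

Definition periodic_points T : set X :=
  [set x | exists n, (0 < n)%N /\ iter n T x = x].

Definition chaotic T : Prop := hypercyclic T /\ dense (periodic_points T).

Definition U_frequently_hypercyclic (R : realType) (a : R^nat) T : Prop :=
  exists x, forall U : set X, open U -> U !=set0 ->
    (0 < upper_density a [set n | U (iter n T x)])%E.

End dynamics.

(* Main.v *)
Require Import Defs.
From mathcomp Require Import all_boot all_order all_algebra.
From mathcomp Require Import all_classical all_reals all_analysis.
From mathcomp Require Import complex.
From mathcomp Require Import zify ring lra.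

(** The basis of the sequence space is cut into consecutive blocks, block [n]
    having length [D n]. Along block [n] the operator [T] moves each unit vector
    to the next one, doubling it during the first [ramp n] steps (the ramp) and
    keeping its size afterwards; from the last vector it comes back to the
    beginning of the block, undoing the amplification, with the opposite sign
    and with a correction supported by the earlier blocks. So, writing [f] for
    the first unit vector of block [n], one has [T^(D n) f = g n - f], where the
    feedback vector [g n] lives on the earlier blocks. Since [2 * D n] divides
    all the later lengths, [T^(D n)] fixes [g n], hence [T^(2 * D n) f = f]:
    every finitely supported vector is periodic, and on the earlier blocks [T]
    is power bounded with an explicit constant ([tame_all]).

    _Chaos_. The vector [hvec] carries at the beginning of block [n] the tiny
    coefficient [2^-lag n], and [g n] is [2^lag n] times [z n] minus the part of
    [hvec] before block [n], where [z] is a dense sequence. At time [D n] that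
    part is back to itself and cancels, the later blocks have not grown yet, and
    [hvec] is sent close to [z n] ([hvec_orbit]).

    _Few visits near zero_. For an arbitrary vector [x], let [mass n] be the
    size of the block [n] of [x] once all its coordinates are past the ramp.
    Each coordinate is on the ramp for [ramp n] times out of [D n], so the block
    has at least half of its mass except for a small proportion of times. What a
    later block [m] can send back is at most [2^-(m + 3)] times its mass, and
    [2^-(m + 3)] times its norm as long as the time is less than [D m - ramp m]
    ([influence]). If the masses are eventually at most [|x| + 1], this shows
    that the first coordinate stays bounded along the orbit, and [x] is not even
    hypercyclic. Otherwise, up to any large time [N], choose among the blocks
    with [D n - ramp n <= N] and [n >= n0] the one with the largest mass: no
    later block can compensate it before time [N], so the orbit is in a fixed
    ball around zero only while half of the mass of block [n] is on the ramp
    ([few_visits]).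

    _Weights_. A non-decreasing weight [a] gives to a residue class modulo [D n]
    at most a share [1 / D n] of its sum up to time [N], plus one term [a N]
    ([residue_weight]). The visits up to [N] thus have relative weight at most
    [2 * (ramp n / D n + ramp n * a N / (a 0 + ... + a N))]. As [v_n(a)] tends
    to 0, taking [D n] large enough with respect to [ramp n] makes this at most
    [4 / (n + 1)] for all [N >= D n - ramp n]; since [n >= n0] was arbitrary,
    the visits have upper density zero. *)

Set Implicit Arguments.
Unset Strict Implicit.
Unset Printing Implicit Defensive.

Import Order.TTheory GRing.Theory Num.Theory.
Import numFieldNormedType.Exports.
Import ComplexField.Normc.

Local Open Scope classical_set_scope.
Local Open Scope ring_scope.
Local Open Scope complex_scope.

#[local] Arguments ell1_seq : simpl never.

(** * Norm, coordinates and truncations in the sequence space *)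

Section ell1_toolkit.
Variable R : realType.
Local Notation ell1 := (ell1 R).
Implicit Types (x y : ell1) (k K N : nat).

(** The norm of [ell1] lives in [R[i]]; its real avatar allows order reasoning
    over the totally ordered field [R]. *)
Definition nrm x : R := limn (series (fun n => normc (x n))).

Definition psum K x : R := \sum_(0 <= k < K) normc (x k).

Lemma normE x : `|x| = (nrm x)%:C. Proof. by []. Qed.

Lemma normc_real (r : R) : normc r%:C = `|r|.
Proof. by rewrite /normc /= expr0n /= addr0 sqrtr_sqr. Qed.

Lemma nrmD x y : nrm (x + y) <= nrm x + nrm y.
Proof. by have := ler_normD x y; rewrite !normE -rmorphD lecR. Qed.

Lemma nrmZ (l : R[i]) x : nrm (l *: x) = normc l * nrm x.
Proof.
have := normrZ l x; rewrite !normE.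
have -> : `|l| = (normc l)%:C by case: l.
by rewrite -rmorphM => -[].
Qed.

Lemma nrmN x : nrm (- x) = nrm x.
Proof. by have := normrN x; rewrite !normE => -[]. Qed.

Lemma nrm0 : nrm 0 = 0.
Proof. by have := normr0 ell1; rewrite normE => -[]. Qed.

Lemma nrmB x y : nrm (x - y) <= nrm x + nrm y.
Proof. by rewrite -(nrmN y) nrmD. Qed.

Lemma nrm_ge0 x : 0 <= nrm x.
Proof. by have := normr_ge0 x; rewrite normE lecR. Qed.

Lemma nrm_sum (I : Type) (r : seq I) (P : pred I) (F : I -> ell1) :
  nrm (\sum_(i <- r | P i) F i) <= \sum_(i <- r | P i) nrm (F i).
Proof.
elim/big_rec2: _ => [|i y1 y2 _ le_y]; first by rewrite nrm0.
by apply: (le_trans (nrmD _ _)); rewrite lerD2l.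
Qed.

Lemma psum_ge0 K x : 0 <= psum K x.
Proof. by apply: sumr_ge0 => k _; exact: normc_ge0. Qed.

Lemma psum_le_nrm K x : psum K x <= nrm x.
Proof.
apply: (nondecreasing_cvgn_le _ (@abs_summableP _ x)).
by apply: nondecreasing_series => i _ _; exact: normc_ge0.
Qed.

Lemma nrm_le x (C : R) : (forall N, psum N x <= C) -> nrm x <= C.
Proof.
move=> H; apply: limr_le; first exact: (@abs_summableP _ x).
by apply: nearW => N; exact: H.
Qed.

Lemma coordD x y k : (x + y) k = x k + y k. Proof. by []. Qed.
Lemma coordN x k : (- x) k = - x k. Proof. by []. Qed.
Lemma coordB x y k : (x - y) k = x k - y k. Proof. by []. Qed.
Lemma coordZ (l : R[i]) x k : (l *: x) k = l * x k. Proof. by []. Qed.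

Lemma coord_sum (I : Type) (r : seq I) (P : pred I) (F : I -> ell1) k :
  (\sum_(i <- r | P i) F i) k = \sum_(i <- r | P i) F i k.
Proof. by elim/big_rec2: _ => // i y1 y2 _ <-. Qed.

Lemma mem_ell1 (x : nat -> R[i]^o) (C : R) :
  (forall N, \sum_(0 <= k < N) normc (x k) <= C) -> x \in @ell1_pred R.
Proof.
move=> H; apply/asboolP/nondecreasing_is_cvgn.
  by apply: nondecreasing_series => i _ _; exact: normc_ge0.
by exists C => _ [N _ <-]; exact: H.
Qed.

Lemma psum_delta k N :
  \sum_(0 <= j < N) normc ((j == k)%:R : R[i]) <= 1.
Proof.
rewrite (eq_bigr (fun j => if j == k then 1 else 0)) => [|j _]; last first.
  by case: (j == k); rewrite ?normc1 ?normc0.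
by rewrite -big_mkcond big_nat1_eq; case: ifP.
Qed.

Definition evec k : ell1 :=
  Ell1 (@mem_ell1 (fun j => (j == k)%:R) 1 (psum_delta k)).

Lemma evecE k j : evec k j = (j == k)%:R. Proof. by []. Qed.

Lemma nrm_evec k : nrm (evec k) = 1.
Proof.
apply/le_anti/andP; split; first exact/nrm_le/psum_delta.
apply: le_trans (psum_le_nrm k.+1 _).
rewrite /psum big_nat_recr //= evecE eqxx normc1 lerDr.
by apply: sumr_ge0 => j _; exact: normc_ge0.
Qed.

Definition trunc K x : ell1 := \sum_(0 <= k < K) x k *: evec k.

Lemma truncE K x j : trunc K x j = if (j < K)%N then x j else 0.
Proof.
rewrite coord_sum.
rewrite (eq_bigr (fun i => if i == j then x j else 0)) => [|i _]; last first.
  rewrite coordZ evecE eq_sym.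
  by case: eqP => [->|_]; rewrite ?mulr1 ?mulr0.
by rewrite -big_mkcond big_nat1_eq.
Qed.

Lemma nrm_trunc K x : nrm (trunc K x) <= nrm x.
Proof.
apply: nrm_le => N; apply: le_trans (psum_le_nrm N x).
apply: ler_sum => k _; rewrite truncE.
by case: ifP => // _; rewrite normc0 normc_ge0.
Qed.

Definition supported K x := forall k, (K <= k)%N -> x k = 0.

Lemma ell1P x y : (forall k, x k = y k) -> x = y.
Proof. by move=> H; apply/val_inj/funext. Qed.

Lemma supported_trunc K x : supported K x -> trunc K x = x.
Proof.
by move=> sx; apply: ell1P => k; rewrite truncE; case: ltnP => // /sx ->.
Qed.

Lemma supportedW K K' x : (K <= K')%N -> supported K x -> supported K' x.
Proof. by move=> KK' sx k K'k; apply: sx; exact: leq_trans K'k. Qed.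

Lemma trunc_supported K x : supported K (trunc K x).
Proof. by move=> k Kk; rewrite truncE ltnNge Kk. Qed.

Lemma supported0 K : supported K 0. Proof. by []. Qed.

Lemma supported_evec k K : (k < K)%N -> supported K (evec k).
Proof. by move=> kK j Kj; rewrite evecE gtn_eqF // (leq_trans kK). Qed.

Lemma supportedD K x y : supported K x -> supported K y -> supported K (x + y).
Proof.
by move=> sx sy k Kk; rewrite coordD sx // sy // addr0.
Qed.

Lemma supportedZ K (l : R[i]) x : supported K x -> supported K (l *: x).
Proof. by move=> sx k Kk; rewrite coordZ sx // mulr0. Qed.

Lemma supportedN K x : supported K x -> supported K (- x).
Proof. by move=> sx k Kk; rewrite coordN sx // oppr0. Qed.

Lemma supported_sum K (I : Type) (r : seq I) (P : pred I) (F : I -> ell1) :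
  (forall i, P i -> supported K (F i)) -> supported K (\sum_(i <- r | P i) F i).
Proof.
move=> H; elim/big_rec: _ => [|i y Pi sy]; first exact: supported0.
by apply: supportedD => //; exact: H.
Qed.

Lemma psum_supported K N x : supported K x -> (K <= N)%N -> psum N x = psum K x.
Proof.
move=> sx KN; rewrite /psum (big_cat_nat (n := K)) //= [X in _ + X]big1_seq ?addr0//.
by move=> k; rewrite mem_index_iota => /andP[_ /andP[Kk _]]; rewrite sx // normc0.
Qed.

Lemma nrm_supported K x : supported K x -> nrm x = psum K x.
Proof.
move=> sx; apply/le_anti/andP; split; last exact: psum_le_nrm.
apply: nrm_le => N; case: (leqP K N) => [KN|/ltnW NK].
  by rewrite (psum_supported sx KN).
rewrite /psum [leRHS](big_cat_nat (n := N)) //= lerDl.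
by apply: sumr_ge0 => k _; exact: normc_ge0.
Qed.

Lemma trunc_approx x (e : R) : 0 < e ->
  exists K0, forall K, (K0 <= K)%N -> nrm (x - trunc K x) < e.
Proof.
move=> e0; have e20 : 0 < e / 2 by rewrite divr_gt0.
have /cvgrPdist_lt/(_ _ e20)[K0 _ HK0] := @abs_summableP _ x.
exists K0 => K K0K; apply: (@le_lt_trans _ _ (e / 2)); last first.
  by rewrite ltr_pdivrMr// ltr_pMr// ltr1n.
apply: nrm_le => N; apply: (@le_trans _ _ (nrm x - psum K x)); last first.
  by apply: ltW; apply: le_lt_trans (HK0 _ K0K); exact: ler_norm.
rewrite lerBrDr; apply: le_trans (psum_le_nrm (maxn N K) x).
rewrite [psum (maxn N K) x]/psum (big_cat_nat (n := K)) ?leq_maxr//= [leLHS]addrC lerD2l.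
apply: (@le_trans _ _ (psum (maxn N K) (x - trunc K x))).
  rewrite [leRHS](big_cat_nat (n := N)) ?leq_maxl//= lerDl.
  by apply: sumr_ge0 => k _; exact: normc_ge0.
rewrite /psum (big_cat_nat (n := K)) ?leq_maxr//= [X in X + _]big1_seq ?add0r.
  apply: ler_sum_nat => k /andP[Kk _].
  by rewrite coordB truncE ltnNge Kk subr0.
move=> k; rewrite mem_index_iota => /andP[_ /andP[_ kK]].
by rewrite coordB truncE kK subrr normc0.
Qed.

(** The norm of [x] is the sum of the norms of its components along the unit
    vectors, so a continuous seminorm only has to be estimated on unit vectors.
    Continuity, expressed by [M], is what lets truncations converge under [q]. *)
Lemma seminorm_le (q : ell1 -> R) (M C : R) :
  (forall x y, q (x + y) <= q x + q y) ->
  (forall l x, q (l *: x) <= normc l * q x) ->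
  (forall x, q x <= M * nrm x) ->
  forall x, (forall K, \sum_(0 <= k < K) normc (x k) * q (evec k) <= C) ->
  q x <= C.
Proof.
move=> qD qZ qM x HC; apply/ler_addgt0Pr => e e0.
have M1 : 0 < `|M| + 1 by rewrite ltr_wpDl.
have [K0 /(_ _ (leqnn _)) HK] := trunc_approx x (divr_gt0 e0 M1).
rewrite -(subrK (trunc K0 x) x) addrC.
apply: (le_trans (qD _ _)); apply: lerD.
  apply: le_trans (HC K0); rewrite /trunc.
  have q0 : q 0 <= 0 by have := qM 0; rewrite nrm0 mulr0.
  elim/big_rec2: _ => // k y1 y2 _ le_y.
  by apply: (le_trans (qD _ _)); apply: lerD.
apply: (le_trans (qM _)); apply: (@le_trans _ _ ((`|M| + 1) * nrm (x - trunc K0 x))).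
  rewrite ler_wpM2r ?nrm_ge0 //; apply: (le_trans (ler_norm M)).
  by rewrite lerDl.
by rewrite mulrC -ler_pdivlMr // ltW.
Qed.

(** * Operators given by their columns *)

Lemma is_cvg_columns (col : nat -> ell1) (M : R) x :
  (forall k, nrm (col k) <= M) -> cvgn (series (fun k => x k *: col k)).
Proof.
move=> colM; apply/cauchy_cvgP/cauchy_seriesP => e e0.
have eE : e = (complex.Re e)%:C by apply/esym/RRe_real/gtr0_real.
have {}e0 : 0 < complex.Re e by rewrite -ltcR -eE.
have M1 : 0 < `|M| + 1 by rewrite ltr_wpDl.
have /cauchy_cvgP/cauchy_seriesP/(_ _ (divr_gt0 e0 M1)) := @abs_summableP _ x.
apply: filterS => -[m n] /=; rewrite eE normE ltcR ltr_pdivlMr // => Hmn.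
apply: le_lt_trans Hmn; apply: (le_trans (nrm_sum _ _ _)).
rewrite ger0_norm ?sumr_ge0// => [|k _]; last exact: normc_ge0.
rewrite mulr_suml; apply: ler_sum => k _; rewrite nrmZ.
apply: ler_wpM2l; first exact: normc_ge0.
by apply: (le_trans (colM k)); apply: (le_trans (ler_norm M)); rewrite lerDl.
Qed.

Lemma cvg_nrm_le (u : nat -> ell1) (l : ell1) (C : R) :
  u @ \oo --> l -> (forall n, nrm (u n) <= C) -> nrm l <= C.
Proof.
move=> ul uC; apply/ler_addgt0Pr => e e0.
have e0' : 0 < e%:C by rewrite ltcR.
have /cvgrPdist_le/(_ _ e0')[n _ /(_ n (leqnn n))] := ul.
rewrite normE lecR => Hn; rewrite -(subrK (u n) l) addrC.
by apply: (le_trans (nrmD _ _)); apply: lerD.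
Qed.

(** The columns weighted by the coordinates of [x] form an absolutely convergent
    series as soon as they are uniformly bounded, and [ell1] is complete. *)
Lemma operator_of_columns (col : nat -> ell1) (M : R) : 0 <= M ->
  (forall k, nrm (col k) <= M) ->
  exists T : ell1 -> ell1, [/\ linear T, (forall x, nrm (T x) <= M * nrm x)
    & forall k, T (evec k) = col k].
Proof.
move=> M0 colM; have cv x := @is_cvg_columns col M x colM.
exists (fun x => limn (series (fun k => x k *: col k))); split.
- move=> l x y; apply: cvg_lim => //.
  rewrite (_ : series _ = (fun n => l *: series (fun k => x k *: col k) n +
      series (fun k => y k *: col k) n)); last first.
    apply/funext => n; rewrite /series /= scaler_sumr -big_split /=.
    by apply: eq_bigr => k _; rewrite scalerA -scalerDl.
  apply: cvgD; last exact: cv.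
  by apply: cvgZl_tmp; exact: cv.
- move=> x; apply: (cvg_nrm_le (cv x)) => n.
  apply: (le_trans (nrm_sum _ _ _)).
  apply: (@le_trans _ _ (M * psum n x)); last by rewrite ler_wpM2l // psum_le_nrm.
  rewrite mulr_sumr; apply: ler_sum => k _; rewrite nrmZ mulrC.
  by rewrite ler_wpM2r // normc_ge0.
- move=> k; apply: cvg_lim => //; apply: cvg_near_cst; exists k.+1 => //= n kn.
  rewrite /series /= (bigD1_seq k) /= ?mem_index_iota ?iota_uniq //.
  by rewrite evecE eqxx scale1r big1 ?addr0 // => i /negPf ik; rewrite evecE ik scale0r.
Qed.

End ell1_toolkit.
(** * Block structure *)

Section blocks.
Variable D : nat -> nat.

Definition start n := (\sum_(0 <= m < n) D m)%N.
(** [2^-lag n] is the coefficient of the hypercyclic vector at the beginning of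
    block [n], and [2^ramp n] the amplification along this block. Relatively to
    this amplification the feedback also has size about [2^-lag n], which must
    beat the norm growth on the earlier blocks, at most [2^start n], with a margin
    summable over [n]. As [ramp n] is twice [lag n], the coefficient and the
    feedback are both small, and the amplification exactly compensates them. *)
Definition lag n := (start n + 2 * n + 4)%N.
Definition ramp n := (2 * lag n)%N.

Lemma startS n : start n.+1 = (start n + D n)%N.
Proof. by rewrite /start big_nat_recr. Qed.

Lemma leq_start m n : (m <= n)%N -> (start m <= start n)%N.
Proof.
by elim: n => [|n IH]; [rewrite leqn0 => /eqP->|rewrite leq_eqVlt => /orP[/eqP->//|
  /IH le]; rewrite startS (leq_trans le) // leq_addr].
Qed.

(** Block [n] has period [2 * D n], because of the sign change after one turn:
    the divisibility makes all the earlier blocks periodic at time [D n]. *)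
Record block_lengths : Prop := BlockLengths {
  ramp_lt : forall n, (ramp n < D n)%N;
  dvdn_blocks : forall n, (2 * D n %| D n.+1)%N }.

Hypothesis HD : block_lengths.

Lemma blocks_gt0 n : (0 < D n)%N.
Proof. exact: leq_ltn_trans (ramp_lt HD n). Qed.

Lemma leq_id_start n : (n <= start n)%N.
Proof.
elim: n => // n IH; rewrite startS -addn1 leq_add //; exact: blocks_gt0.
Qed.

(** Walking through the blocks avoids having to invert [start]. *)
Fixpoint block_pos k : nat * nat :=
  if k is k'.+1 then
    let: (n, i) := block_pos k' in
    if (i.+1 < D n)%N then (n, i.+1) else (n.+1, 0%N)
  else (0%N, 0%N).

Lemma block_posP k :
  let: (n, i) := block_pos k in k = (start n + i)%N /\ (i < D n)%N.
Proof.
elim: k => [|k]; first by rewrite /= /start big_geq //; split => //; exact: blocks_gt0.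
rewrite /=; case: (block_pos k) => n i [-> iD]; case: ltnP => [|Di].
  by rewrite addnS.
split; last exact: blocks_gt0.
by rewrite startS addn0; lia.
Qed.

Lemma block_ind (P : nat -> Prop) :
  (forall n i, (i < D n)%N -> P (start n + i)%N) -> forall k, P k.
Proof.
by move=> H k; have := block_posP k; case: (block_pos k) => n i [-> ?]; exact: H.
Qed.

Lemma block_posE n i : (i < D n)%N -> block_pos (start n + i) = (n, i).
Proof.
move=> iD; have := block_posP (start n + i); case: (block_pos _) => m j [E jD].
have : m = n.
  case: (ltngtP m n) => // [/leq_start|/leq_start]; rewrite startS; lia.
by move=> mn; move: E; rewrite mn => /addnI ->.
Qed.

Lemma sum_blocks (V : nmodType) (F : nat -> V) M :
  \sum_(0 <= k < start M) F k =
  \sum_(0 <= m < M) \sum_(0 <= i < D m) F (start m + i)%N.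
Proof.
elim: M => [|M IH]; first by rewrite /start !big_geq.
rewrite big_nat_recr //= -IH (big_cat_nat (n := start M)) ?leq_start //=.
congr (_ + _); rewrite startS -{1}(add0n (start M)) big_addn addKn.
by apply: eq_bigr => i _; rewrite addnC.
Qed.

End blocks.

(** * Orbits of the unit vectors *)

Section orbits.
Variables (R : realType) (D : nat -> nat).
Hypothesis HD : block_lengths D.
Local Notation ell1 := (ell1 R).
Local Notation start := (start D).
Local Notation lag := (lag D).
Local Notation ramp := (ramp D).

(** The growth of a vector that has walked from the beginning of block [n] to
    offset [i]: it doubles on the ramp only. *)
Definition wt n i : R := 2 ^+ minn i (ramp n).

Lemma wt_ge1 n i : 1 <= wt n i. Proof. by rewrite exprn_ege1 // ler1n. Qed.
Lemma wt_gt0 n i : 0 < wt n i. Proof. exact: lt_le_trans (wt_ge1 n i). Qed.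
Lemma wt_neq0 n i : wt n i != 0. Proof. by rewrite gt_eqF // wt_gt0. Qed.
Lemma wt_le n i : wt n i <= 2 ^+ ramp n.
Proof. by rewrite /wt ler_weXn2l ?ler1n // geq_minr. Qed.
Lemma wt_top n i : (ramp n <= i)%N -> wt n i = 2 ^+ ramp n.
Proof. by move=> /minn_idPr ri; rewrite /wt ri. Qed.

Definition fvec n i : ell1 := (wt n i)%:C *: evec R (start n + i).

Lemma evec_fvec n i : evec R (start n + i) = ((wt n i)^-1)%:C *: fvec n i.
Proof. by rewrite scalerA -rmorphM /= mulVf ?wt_neq0 // scale1r. Qed.

Lemma normc_wt n i : normc (wt n i)%:C = wt n i.
Proof. by rewrite normc_real ger0_norm // ltW // wt_gt0. Qed.

Lemma normc_wtV n i : normc ((wt n i)^-1)%:C = (wt n i)^-1.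
Proof. by rewrite normc_real ger0_norm // invr_ge0 ltW // wt_gt0. Qed.

Lemma normc_sign q : normc ((-1) ^+ q : R[i]) = 1.
Proof.
by elim: q => [|q IH]; rewrite ?expr0 ?normc1 // exprS normcM IH mulr1 normcN normc1.
Qed.

Lemma nrm_fvec n i : nrm (fvec n i) = wt n i.
Proof. by rewrite nrmZ nrm_evec mulr1 normc_wt. Qed.

Variables (g : nat -> ell1) (T : ell1 -> ell1).

(** [T] walks through each block along the vectors [fvec n i] and, at the end
    of block [n], comes back to its beginning with the opposite sign, up to
    the vector [g n] sent to the earlier blocks. *)
Record block_operator : Prop := BlockOperator {
  op_linear : linear T;
  op_bounded : forall x, nrm (T x) <= 2 * nrm x;
  op_next : forall n i, (i.+1 < D n)%N -> T (fvec n i) = fvec n i.+1;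
  op_last : forall n, T (fvec n (D n).-1) = g n - fvec n 0;
  feedback_supported : forall n, supported (start n) (g n);
  feedback_le : forall n, nrm (g n) <= 2 ^+ (lag n + n.+1) }.

Hypothesis HT : block_operator.

Lemma iter_lin j l x y : iter j T (l *: x + y) = l *: iter j T x + iter j T y.
Proof. by elim: j => //= j ->; rewrite (op_linear HT). Qed.

Lemma iterD_op j x y : iter j T (x + y) = iter j T x + iter j T y.
Proof. by have := iter_lin j 1 x y; rewrite !scale1r. Qed.

Lemma iter0_op j : iter j T 0 = 0.
Proof. by have := iter_lin j (-1) 0 0; rewrite scaler0 add0r scaleN1r addNr. Qed.

Lemma iterZ_op j l x : iter j T (l *: x) = l *: iter j T x.
Proof. by have := iter_lin j l x 0; rewrite iter0_op !addr0. Qed.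

Lemma iterB_op j x y : iter j T (x - y) = iter j T x - iter j T y.
Proof. by rewrite -scaleN1r iterD_op iterZ_op scaleN1r. Qed.

Lemma iter_sum_op j (I : Type) (r : seq I) (F : I -> ell1) :
  iter j T (\sum_(i <- r) F i) = \sum_(i <- r) iter j T (F i).
Proof.
by elim: r => [|i r IH]; rewrite ?big_nil ?iter0_op // !big_cons iterD_op IH.
Qed.

Lemma nrm_iter j x : nrm (iter j T x) <= 2 ^+ j * nrm x.
Proof.
elim: j => [|j IH] /=; first by rewrite expr0 mul1r.
by apply: le_trans (op_bounded HT _) _; rewrite exprS -mulrA ler_pM2l.
Qed.

Lemma iter_fvec n i : (i < D n)%N -> iter i T (fvec n 0) = fvec n i.
Proof. by elim: i => //= i IH iD; rewrite IH ?(op_next HT) // ltnW. Qed.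

Lemma iter_block n : iter (D n) T (fvec n 0) = g n - fvec n 0.
Proof.
have D0 := blocks_gt0 HD n.
by rewrite -{1}(prednK D0) iterS iter_fvec ?(op_last HT) // prednK.
Qed.

(** The feedback of block [n] only sees the earlier blocks, whence the closed form
    of the orbits in block [n]; this in turn extends the property to the next
    space. *)
Definition tame n := forall y, supported (start n) y ->
  [/\ forall j, supported (start n) (iter j T y), iter (D n) T y = y
    & forall j, nrm (iter j T y) <= 2 ^+ start n * nrm y].

Lemma iter_fix (x : ell1) d q : iter d T x = x -> iter (q * d) T x = x.
Proof. by move=> dx; elim: q => // q IH; rewrite mulSn iterD IH. Qed.

(** [g n] is fixed by [T^(D n)]: each turn adds the orbit of [g n] and changes
    the sign, so that the feedback of two consecutive turns cancels and at most
    one copy of it is present at any time. *)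
Lemma orbit_fvec_of_tame n q r : tame n -> (r < D n)%N ->
  iter (q * D n + r) T (fvec n 0) =
  (-1) ^+ q *: fvec n r + (if odd q then iter r T (g n) else 0).
Proof.
move=> tn rD; have [_ gD _] := tn _ (@feedback_supported HT n).
elim: q => [|q IH]; first by rewrite scale1r addr0 iter_fvec.
rewrite mulSn -addnA addnC iterD iter_block iterB_op IH.
rewrite addnC iterD (iter_fix _ gD) exprS mulN1r scaleNr.
rewrite [odd q.+1]/=; case: (odd q) => /=; last by rewrite addr0 addrC.
by rewrite addr0 opprD addrCA subrr addr0.
Qed.

(** The factor [2^-(n + 3)] lost with respect to the amplification [2^ramp n] is
    what makes the total influence of the later blocks summable. *)
Lemma feedback_orbit_of_tame n j : tame n ->
  2 ^+ (n + 3) * nrm (iter j T (g n)) <= 2 ^+ ramp n.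
Proof.
move=> tn; have [_ _ /(_ j) gj] := tn _ (@feedback_supported HT n).
apply: (@le_trans _ _ (2 ^+ (n + 3) * (2 ^+ start n * 2 ^+ (lag n + n.+1)))).
  rewrite ler_pM2l ?exprn_gt0 //; apply: (le_trans gj).
  by rewrite ler_pM2l ?exprn_gt0 // (feedback_le HT).
by rewrite -!exprD ler_weXn2l ?ler1n // /ramp /lag; lia.
Qed.

Lemma tame_of_evec n :
  (forall k, (k < start n)%N ->
    [/\ forall j, supported (start n) (iter j T (evec R k)),
      iter (D n) T (evec R k) = evec R k
    & forall j, nrm (iter j T (evec R k)) <= 2 ^+ start n]) -> tame n.
Proof.
move=> tameB y sy; rewrite -{1 2 3 4}(supported_trunc sy); split => [j||j].
- rewrite iter_sum_op big_seq; apply: supported_sum => k.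
  rewrite mem_index_iota iterZ_op => /andP[_ /tameB[+ _ _]].
  by move=> /(_ j); exact: supportedZ.
- rewrite iter_sum_op; apply: eq_big_seq => k.
  by rewrite mem_index_iota iterZ_op => /andP[_ /tameB[_ -> _]].
- rewrite iter_sum_op (nrm_supported sy); apply: (le_trans (nrm_sum _ _ _)).
  rewrite mulr_sumr; apply: ler_sum_nat => k /andP[_ /tameB[_ _ /(_ j) +]].
  by rewrite iterZ_op nrmZ mulrC => ?; rewrite ler_wpM2r // normc_ge0.
Qed.

Lemma tame_all n : tame n.
Proof.
elim: n => [|n IH]; first by apply: tame_of_evec => k; rewrite /start big_geq.
apply: tame_of_evec => k; rewrite startS => kS.
have /dvdnP[q Dq] := dvdn_blocks HD n.
case: (ltnP k (start n)) => [kn|kn].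
  have [k1 k2 k3] := IH _ (@supported_evec R _ _ kn); split => [j||j].
  - exact: supportedW (leq_addr _ _) (k1 j).
  - by rewrite Dq mulnA; exact: iter_fix.
  - apply: le_trans (k3 j) _.
    by rewrite nrm_evec mulr1 ler_weXn2l ?ler1n // leq_addr.
have [i iD ->] : exists2 i, (i < D n)%N & k = (start n + i)%N.
  by exists (k - start n)%N; lia.
have D0 := blocks_gt0 HD n.
have rE j : iter j T (fvec n i) = (-1) ^+ ((j + i) %/ D n) *: fvec n ((j + i) %% D n)
    + (if odd ((j + i) %/ D n) then iter ((j + i) %% D n) T (g n) else 0).
  by rewrite -orbit_fvec_of_tame ?ltn_mod // -divn_eq iterD iter_fvec.
(* Two turns give the identity. *)
have per : iter (D n.+1) T (fvec n i) = fvec n i.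
  have := orbit_fvec_of_tame 2 IH D0; rewrite addn0 /= expr2 mulrNN mul1r scale1r addr0.
  move=> /(iter_fix q) E.
  by rewrite -(iter_fvec iD) -iterD addnC iterD Dq E.
rewrite evec_fvec; split => [j||j]; rewrite iterZ_op.
- apply: supportedZ; rewrite rE; apply: supportedD.
    by do 2!apply: supportedZ; apply: supported_evec; rewrite ltn_add2l ltn_mod.
  case: ifP => // _; apply: supportedW (leq_addr _ _) _.
  by have [+ _ _] := IH _ (@feedback_supported HT n); exact.
- by rewrite per.
- rewrite nrmZ normc_wtV ler_pdivrMl ?wt_gt0 //.
  apply: (@le_trans _ _ (2 ^+ (start n + D n))); last first.
    by rewrite ler_peMl ?exprn_ge0 // wt_ge1.
  apply: (@le_trans _ _ (2 ^+ ramp n + 2 ^+ ramp n)); last first.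
    rewrite (_ : 2 ^+ ramp n + _ = 2 ^+ (ramp n).+1); last by rewrite exprS mulr_natl mulr2n.
    rewrite ler_weXn2l ?ler1n //.
    exact: leq_trans (ramp_lt HD n) (leq_addl _ _).
  rewrite rE; apply: (le_trans (nrmD _ _)); apply: lerD.
    by rewrite nrmZ normc_sign mul1r nrm_fvec wt_le.
  case: ifP => _; last by rewrite nrm0 exprn_ge0.
  apply: le_trans (feedback_orbit_of_tame ((j + i) %% D n) IH).
  by rewrite ler_peMl ?nrm_ge0 // exprn_ege1 // ler1n.
Qed.

Lemma orbit_supported n j y :
  supported (start n) y -> supported (start n) (iter j T y).
Proof. by move=> /tame_all[]. Qed.

Lemma orbit_periodic n y : supported (start n) y -> iter (D n) T y = y.
Proof. by move=> /tame_all[]. Qed.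

Lemma orbit_le n j y :
  supported (start n) y -> nrm (iter j T y) <= 2 ^+ start n * nrm y.
Proof. by move=> /tame_all[]. Qed.

Lemma feedback_orbit n j : 2 ^+ (n + 3) * nrm (iter j T (g n)) <= 2 ^+ ramp n.
Proof. exact: (feedback_orbit_of_tame j (@tame_all n)). Qed.

Lemma orbit_fvec n j : let q := (j %/ D n)%N in let r := (j %% D n)%N in
  iter j T (fvec n 0) =
  (-1) ^+ q *: fvec n r + (if odd q then iter r T (g n) else 0).
Proof.
move=> q r; rewrite {1}(divn_eq j (D n)).
by apply: (orbit_fvec_of_tame _ (@tame_all n)); rewrite ltn_mod blocks_gt0.
Qed.

End orbits.
(** * Chaos *)

Section density_ell1.
Variable R : realType.
Local Notation ell1 := (ell1 R).

Lemma dense_nrm (S : set ell1) :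
  (forall y e, 0 < e -> exists2 s, S s & nrm (y - s) < e) -> dense S.
Proof.
move=> H O [y Oy] oO; have /nbhs_ballP[e /= e0 eO] := open_nbhs_nbhs (conj oO Oy).
have eE : e = (complex.Re e)%:C by apply/esym/RRe_real/gtr0_real.
have [|s Ss ys] := H y (complex.Re e); first by rewrite -ltcR -eE.
exists s; split => //; apply: eO.
by rewrite -ball_normE /= normE eE ltcR.
Qed.

Lemma rat_approx (r e : R) : 0 < e -> exists q : rat, `|r - ratr q| < e.
Proof.
move=> e0; have [|q] := @rat_in_itvoo R (r - e) (r + e); first lra.
rewrite in_itv /= => /andP[q1 q2]; exists q; rewrite ltr_norml; lra.
Qed.

Definition ratvec (s : seq (rat * rat)) : ell1 :=
  \sum_(0 <= k < size s)
    (ratr (nth (0, 0) s k).1 +i* ratr (nth (0, 0) s k).2) *: evec R k.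

Lemma ratvec_supported s : supported (size s) (ratvec s).
Proof.
rewrite /ratvec big_seq; apply: supported_sum => k; rewrite mem_index_iota => /andP[_ ks].
by apply: supportedZ; exact: supported_evec.
Qed.

Lemma ratvec_dense y (e : R) : 0 < e -> exists s, nrm (y - ratvec s) < e.
Proof.
move=> e0; have e20 : 0 < e / 2 by rewrite divr_gt0.
have [K /(_ _ (leqnn K)) yK] := trunc_approx y e20.
pose d : R := e / 2 / 2 / K.+1%:R.
have d0 : 0 < d by rewrite !divr_gt0.
have [qr Hqr] := choice (fun k => rat_approx (complex.Re (y k)) d0).
have [qi Hqi] := choice (fun k => rat_approx (complex.Im (y k)) d0).
exists (mkseq (fun k => (qr k, qi k)) K).
set s := mkseq _ _; have sK : size s = K by rewrite size_mkseq.
rewrite -(subrK (trunc K y) y) -addrA [ltRHS]splitr.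
apply: (le_lt_trans (nrmD _ _)); apply: ltr_leD => //.
rewrite /ratvec sK /trunc -sumrB; apply: (le_trans (nrm_sum _ _ _)).
apply: (@le_trans _ _ (\sum_(0 <= k < K) (d + d))).
  apply: ler_sum_nat => k /andP[_ kK]; rewrite -scalerBl nrmZ nrm_evec mulr1.
  rewrite nth_mkseq //=; apply: (le_trans (normc_le_ReIm _)).
  rewrite raddfB /= [complex.Im (_ - _)](_ : _ = complex.Im (y k) - ratr (qi k)).
    by apply: lerD; apply: ltW.
  by case: (y k).
rewrite sumr_const_nat subn0.
apply: (@le_trans _ _ ((d + d) *+ K.+1)); first by rewrite mulrSr lerDl ltW // addr_gt0.
rewrite -[leLHS]mulr_natr /d; have : K.+1%:R != 0 :> R by rewrite pnatr_eq0.
by move: K.+1%:R => u u0; rewrite le_eqVlt; apply/orP; left; apply/eqP; field.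
Qed.

Lemma injective_unbounded (f : nat -> nat) M :
  injective f -> exists c, (M <= f c)%N.
Proof.
move=> fi; apply: contrapT => /forallNP H.
have : (size (map f (iota 0 M.+1)) <= size (iota 0 M))%N.
  apply: uniq_leq_size; first by rewrite map_inj_uniq // iota_uniq.
  move=> _ /mapP[c _ ->]; rewrite mem_iota add0n /=.
  by have /negP := H c; rewrite -ltnNge.
by rewrite size_map !size_iota ltnn.
Qed.

(** Every rational vector is proposed infinitely many times, so that it is
    eventually accepted by the slowly relaxed constraints on supports and norms. *)
Lemma dense_targets (K : nat -> nat) : (forall n, (n <= K n)%N) ->
  exists z : nat -> ell1, [/\ forall n, supported (K n) (z n),
    forall n, nrm (z n) <= n%:R
    & forall y e M, 0 < e -> exists2 n, (M <= n)%N & nrm (y - z n) < e].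
Proof.
move=> leK; pose ok n s := (size s <= K n)%N && (nrm (ratvec s) <= n%:R).
exists (fun n => if (unpickle n : option (nat * seq (rat * rat))) is Some (_, s) then
    if ok n s then ratvec s else 0 else 0); split => [n|n|y e M e0].
- case: unpickle => // -[_ s]; case: ifP => // /andP[sK _].
  exact: supportedW sK (@ratvec_supported s).
- case: unpickle => [[_ s]|]; last by rewrite nrm0.
  by case: ifP => [/andP[]//|_]; rewrite nrm0.
- have [s ys] := ratvec_dense y e0.
  have [c Mc] := @injective_unbounded (fun c => pickle (c, s))
    (maxn M (maxn (size s) (Num.bound (nrm (ratvec s)))))
    (fun c c' E => congr1 fst (pcan_inj pickleK E)).
  move: Mc; rewrite !geq_max => /and3P[Mc sc bc].
  exists (pickle (c, s)) => //; rewrite pickleK ifT //; apply/andP; split.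
    exact: leq_trans sc (leK _).
  apply: ltW; apply: lt_le_trans (_ : (Num.bound (nrm (ratvec s)))%:R <= _).
    by apply: le_lt_trans (archi_boundP (nrm_ge0 _)); rewrite lexx.
  by rewrite ler_nat.
Qed.

End density_ell1.

Section hypercyclic_vector.
Variables (R : realType) (D : nat -> nat).
Hypothesis HD : block_lengths D.
Local Notation ell1 := (ell1 R).
Local Notation start := (start D).
Local Notation lag := (lag D).

Lemma sum_half S N :
  \sum_(S <= k < N) (2^-1 ^+ k : R) <= 2 * 2^-1 ^+ S.
Proof.
case: (leqP N S) => [NS|/ltnW SN].
  by rewrite big_geq // mulr_ge0 // exprn_ge0 // invr_ge0.
suff <- : \sum_(S <= k < N) (2^-1 ^+ k : R) + 2 * 2^-1 ^+ N = 2 * 2^-1 ^+ S.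
  by rewrite lerDl mulr_ge0 // exprn_ge0 // invr_ge0.
rewrite -(subnKC SN); elim: (N - S)%N => [|m IH].
  by rewrite addn0 big_geq // add0r.
rewrite addnS big_nat_recr ?leq_addr //= -IH exprS -addrA; congr (_ + _).
by rewrite mulrA mulfV // mul1r; ring.
Qed.

Definition hcoord k : R[i] :=
  let: (n, i) := block_pos D k in if i == 0%N then (2^-1 ^+ lag n)%:C else 0.

Lemma hcoord_le n k : (start n <= k)%N ->
  normc (hcoord k) <= 2^-1 ^+ (2 * n + 4) * 2^-1 ^+ k.
Proof.
elim/(block_ind HD): k => m i im; rewrite /hcoord block_posE //.
case: eqP => [->|_]; last by rewrite normc0 mulr_ge0 // exprn_ge0 // invr_ge0.
rewrite addn0 => nm; rewrite normc_real ger0_norm ?exprn_ge0 ?invr_ge0 //.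
rewrite -exprD ler_wiXn2l ?invr_ge0 ?invf_le1 ?ler1n // /lag.
suff : (n <= m)%N by lia.
rewrite leqNgt; apply/negP => mn.
have := leq_start D mn; rewrite startS.
have := blocks_gt0 HD m; lia.
Qed.

Lemma hcoord_summable N : \sum_(0 <= k < N) normc (hcoord k) <= 1.
Proof.
apply: (@le_trans _ _ (2^-1 ^+ 4 * \sum_(0 <= k < N) 2^-1 ^+ k)).
  by rewrite mulr_sumr; apply: ler_sum => k _; apply: (@hcoord_le 0); rewrite /start big_geq.
apply: (@le_trans _ _ (2^-1 ^+ 4 * (2 * 2^-1 ^+ 0))).
  by rewrite ler_wpM2l ?exprn_ge0 ?invr_ge0 ?sum_half.
by rewrite expr0; lra.
Qed.

Definition hvec : ell1 := Ell1 (mem_ell1 hcoord_summable).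

Lemma hvecE k : hvec k = hcoord k. Proof. by []. Qed.

(** Even with the crude growth bound [2] per step, the blocks after [n] are still
    negligible at time [D n], because [start n.+1] is at least [D n]. *)
Lemma nrm_hvec_tail n :
  2 ^+ D n * nrm (hvec - trunc (start n.+1) hvec) <= 2^-1 ^+ n.+1.
Proof.
set S := start n.+1; have h0 m : 0 <= 2^-1 ^+ m :> R by rewrite exprn_ge0 ?invr_ge0.
have hW m m' : (m <= m')%N -> 2^-1 ^+ m' <= 2^-1 ^+ m :> R.
  by move=> mm'; rewrite ler_wiXn2l ?invr_ge0 ?invf_le1 ?ler1n.
have tailE k : normc ((hvec - trunc S hvec) k) = if (k < S)%N then 0 else normc (hcoord k).
  by rewrite coordB truncE; case: ifP => _; rewrite ?subrr ?normc0 ?subr0.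
have le_tail : nrm (hvec - trunc S hvec) <= 2^-1 ^+ (2 * n.+1 + 4) * (2 * 2^-1 ^+ S).
  apply: nrm_le => N; have c0 : 0 <= 2^-1 ^+ (2 * n.+1 + 4) * (2 * 2^-1 ^+ S) :> R.
    by rewrite !mulr_ge0.
  case: (leqP N S) => [NS|/ltnW SN].
    rewrite /psum big1_seq // => k; rewrite mem_index_iota => /andP[_ /andP[_ kN]].
    by rewrite tailE (leq_trans kN NS).
  rewrite /psum (big_cat_nat (n := S)) //= big1_seq ?add0r => [|k]; last first.
    by rewrite mem_index_iota tailE => /andP[_ /andP[_ ->]].
  apply: le_trans (_ : _ <= 2^-1 ^+ (2 * n.+1 + 4) * \sum_(S <= k < N) 2^-1 ^+ k) _.
    rewrite mulr_sumr; apply: ler_sum_nat => k /andP[Sk _].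
    by rewrite tailE ltnNge Sk /=; exact: hcoord_le.
  by rewrite ler_wpM2l // sum_half.
apply: (@le_trans _ _ (2 ^+ D n * (2^-1 ^+ (2 * n.+1 + 4) * (2 * 2^-1 ^+ D n)))).
  rewrite ler_pM2l ?exprn_gt0 //; apply: (le_trans le_tail).
  by rewrite ler_wpM2l // ler_pM2l // hW // /S startS leq_addl.
have assoc (u c v : R) : u * (c * (2 * v)) = (c * 2) * (u * v) by ring.
rewrite assoc -exprMn mulfV // expr1n mulr1.
rewrite (_ : 2 * n.+1 + 4 = (2 * n.+1 + 3).+1)%N; last lia.
rewrite exprSr -mulrA mulVf // mulr1 hW //; lia.
Qed.

Lemma hvec_split n : hvec =
  trunc (start n) hvec + (2^-1 ^+ lag n)%:C *: fvec R D n 0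
    + (hvec - trunc (start n.+1) hvec).
Proof.
suff <- : trunc (start n.+1) hvec = trunc (start n) hvec + (2^-1 ^+ lag n)%:C *: fvec R D n 0.
  by rewrite addrC subrK.
rewrite {1}/trunc (big_cat_nat (n := start n)) ?leq_start //=; congr (_ + _).
rewrite startS -{1}(add0n (start n)) big_addn addKn.
rewrite big_ltn ?(blocks_gt0 HD) // big1_seq ?addr0 => [|i]; last first.
  rewrite mem_index_iota => /andP[_ /andP[i0 iD]].
  by rewrite addnC hvecE /hcoord block_posE // gtn_eqF // scale0r.
rewrite add0n hvecE /hcoord -{1}(addn0 (start n)) block_posE ?(blocks_gt0 HD) //=.
by rewrite /fvec /wt min0n expr0 scale1r addn0.
Qed.

Variables (z : nat -> ell1).

(** Subtracting the earlier part of [hvec] compensates its return at time [D n]. *)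
Definition feedback n : ell1 := (2 ^+ lag n)%:C *: (z n - trunc (start n) hvec).

Lemma feedback_nrm n : nrm (z n) <= n%:R -> nrm (feedback n) <= 2 ^+ (lag n + n.+1).
Proof.
move=> zn; rewrite nrmZ normc_real ger0_norm ?exprn_ge0 // exprD ler_pM2l ?exprn_gt0 //.
apply: (le_trans (nrmB _ _)); apply: (@le_trans _ _ (n%:R + 1)).
  apply: lerD => //; apply: (le_trans (nrm_trunc _ _)).
  exact/nrm_le/hcoord_summable.
rewrite natr1 -natrX ler_nat; exact: ltnW (ltn_expl _ _).
Qed.

(** At time [D n] the part of [hvec] before block [n] is back to itself, block
    [n] delivers [z n] minus that very part, and the later blocks are still
    negligible. *)
Lemma hvec_orbit T n : block_operator D feedback T ->
  nrm (iter (D n) T hvec - z n) <= 2^-1 ^+ n.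
Proof.
move=> HT; have l0 m : 0 <= 2^-1 ^+ m :> R by rewrite exprn_ge0 ?invr_ge0.
have := nrm_hvec_tail n; have := hvec_split n.
move: (hvec - trunc (start n.+1) hvec) => w -> w_small.
rewrite !(iterD_op HT) (iterZ_op HT) (iter_block HD HT).
rewrite (orbit_periodic HD HT) => [|k]; last exact: trunc_supported.
rewrite scalerBr /feedback scalerA -rmorphM /= -exprMn mulVf // expr1n scale1r.
set p := trunc _ _; set y := iter _ _ _.
have -> : p + (z n - p - (2^-1 ^+ lag n)%:C *: fvec R D n 0) + y - z n =
    y - (2^-1 ^+ lag n)%:C *: fvec R D n 0.
  rewrite [p + _]addrC [_ - _ + p]addrAC subrK [_ + y - _]addrAC [z n - _ - _]addrAC.
  by rewrite subrr add0r addrC.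
apply: (le_trans (nrmB _ _)).
have -> : 2^-1 ^+ n = 2^-1 ^+ n.+1 + 2^-1 ^+ n.+1 :> R.
  by rewrite exprS -mulrDl -[X in X + X]mul1r -mulrDl mulfV // mul1r.
apply: lerD.
  by apply: le_trans w_small; exact: nrm_iter HT _ _.
rewrite nrmZ nrm_fvec normc_real ger0_norm // /wt min0n expr0 mulr1.
by rewrite ler_wiXn2l ?invr_ge0 ?invf_le1 ?ler1n // /lag; lia.
Qed.

End hypercyclic_vector.

Section chaos.
Variables (R : realType) (D : nat -> nat).
Hypothesis HD : block_lengths D.
Local Notation ell1 := (ell1 R).
Variables (g : nat -> ell1) (T : ell1 -> ell1).
Hypothesis HT : block_operator D g T.

Lemma periodic_dense : dense (periodic_points T).
Proof.
apply: dense_nrm => y e e0; have [n /(_ _ (leq_id_start HD n)) yn] := trunc_approx y e0.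
exists (trunc (start D n) y) => //; exists (D n); split; first exact: blocks_gt0 HD n.
by apply: (orbit_periodic HD HT) => k; exact: trunc_supported.
Qed.

End chaos.

Lemma hvec_hypercyclic (R : realType) (D : nat -> nat) (HD : block_lengths D)
    (z : nat -> ell1 R) (T : ell1 R -> ell1 R) :
  block_operator D (feedback HD z) T ->
  (forall y e M, 0 < e -> exists2 n, (M <= n)%N & nrm (y - z n) < e) ->
  hypercyclic T.
Proof.
move=> HT Hz; exists (hvec R HD); apply: dense_nrm => y e e0.
have e20 : 0 < e / 2 by rewrite divr_gt0.
have [M HM] : exists M, forall n, (M <= n)%N -> 2^-1 ^+ n < e / 2.
  have h1 : `|2^-1| < 1 :> R by rewrite ger0_norm ?invr_ge0 ?invf_lt1 ?ltr1n.
  have /cvgrPdist_lt/(_ _ e20)[M _ HM] := cvg_expr h1.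
  exists M => n /HM /=; by rewrite sub0r normrN ger0_norm // exprn_ge0 // invr_ge0.
have [n Mn yz] := Hz y _ M e20.
exists (iter (D n) T (hvec R HD)); first by exists (D n).
rewrite -(subrK (z n) y) -addrA [ltRHS]splitr.
apply: (le_lt_trans (nrmD _ _)); apply: ltrD => //.
rewrite -opprB nrmN; exact: le_lt_trans (hvec_orbit n HT) (HM _ Mn).
Qed.
(** * Blocks dominate the orbit *)

Section domination.
Variables (R : realType) (D : nat -> nat).
Hypothesis HD : block_lengths D.
Local Notation ell1 := (ell1 R).
Local Notation start := (start D).
Local Notation ramp := (ramp D).
Local Notation wt := (wt R D).
Variables (g : nat -> ell1) (T : ell1 -> ell1).
Hypothesis HT : block_operator D g T.

Lemma psumD K (x y : ell1) : psum K (x + y) <= psum K x + psum K y.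
Proof. by rewrite /psum -big_split; apply: ler_sum => k _; exact: le_normcD. Qed.

Lemma psumZ K l (x : ell1) : psum K (l *: x) = normc l * psum K x.
Proof. by rewrite /psum mulr_sumr; apply: eq_bigr => k _; rewrite coordZ normcM. Qed.

Lemma leq_psum K K' (x : ell1) : (K <= K')%N -> psum K x <= psum K' x.
Proof.
move=> KK'; rewrite [leRHS](big_cat_nat (n := K)) //= lerDl.
by apply: sumr_ge0 => k _; exact: normc_ge0.
Qed.

Lemma block_le_psum n (y : ell1) :
  \sum_(0 <= i < D n) normc (y (start n + i)) <= psum (start n.+1) y.
Proof.
rewrite /psum sum_blocks big_nat_recr //= lerDr.
by do 2!apply: sumr_ge0 => ? _; exact: normc_ge0.
Qed.

Lemma evec_orbit n i j : (i < D n)%N ->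
  iter j T (evec R (start n + i)) = ((wt n i)^-1)%:C *:
    ((-1) ^+ ((j + i) %/ D n) *: fvec R D n ((j + i) %% D n) +
     (if odd ((j + i) %/ D n) then iter ((j + i) %% D n) T (g n) else 0)).
Proof.
move=> iD; rewrite evec_fvec (iterZ_op HT); congr (_ *: _).
by rewrite -(orbit_fvec HD HT) iterD (iter_fvec HT).
Qed.

(** Nothing is sent to the earlier blocks before the end of the block is reached;
    afterwards a vector starting high on the ramp has been amplified less. *)
Lemma psum_evec_orbit n i j : (i < D n)%N ->
  2 ^+ (n + 3) * psum (start n) (iter j T (evec R (start n + i))) <=
  if (j + i < D n)%N then 0 else 2 ^+ ramp n / wt n i.
Proof.
move=> iD; rewrite evec_orbit // psumZ normc_wtV.
set q := ((j + i) %/ D n)%N; set r := ((j + i) %% D n)%N.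
apply: (@le_trans _ _ (2 ^+ (n + 3) * ((wt n i)^-1 *
    (if (j + i < D n)%N then 0 else nrm (iter r T (g n)))))); last first.
  case: ifP => _; first by rewrite !mulr0.
  rewrite mulrCA [leRHS]mulrC ler_pM2l ?invr_gt0 ?wt_gt0 //.
  exact: (feedback_orbit HD HT).
rewrite ler_pM2l ?exprn_gt0 // ler_pM2l ?invr_gt0 ?wt_gt0 //.
apply: (le_trans (psumD _ _ _)).
rewrite {1}/psum big1_seq ?add0r => [|k]; last first.
  rewrite mem_index_iota => /andP[_ /andP[_ kn]].
  by rewrite !coordZ evecE ltn_eqF ?mulr0 ?normc0 // ltn_addr.
case: ltnP => [lt|_]; last case: ifP => _.
- by rewrite /q divn_small //= /psum big1 // => k _; rewrite normc0.
- exact: psum_le_nrm.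
- apply: le_trans (nrm_ge0 _).
  by rewrite /psum big1 // => k _; rewrite normc0.
Qed.

Variable x : ell1.

(** The total mass that the coordinates of [x] in block [n] have once they have
    climbed the ramp. *)
Definition mass n : R :=
  2 ^+ ramp n * \sum_(0 <= i < D n) normc (x (start n + i)) / wt n i.

Lemma mass_ge0 n : 0 <= mass n.
Proof.
rewrite mulr_ge0 ?exprn_ge0 // sumr_ge0 // => i _.
by rewrite divr_ge0 ?normc_ge0 // ltW // wt_gt0.
Qed.

(** What block [m] has sent to the earlier blocks by time [j]. Before time
    [D m - ramp m], only coordinates beyond the ramp reached the end of the
    block, and these were not amplified. *)
Lemma block_influence m j (B : R) :
  (mass m <= B) \/ ((j + ramp m < D m)%N /\ nrm x <= B) ->
  \sum_(0 <= i < D m) normc (x (start m + i)) *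
    psum (start m) (iter j T (evec R (start m + i))) <= 2^-1 ^+ (m + 3) * B.
Proof.
move=> H; rewrite -(ler_pM2l (_ : 0 < 2 ^+ (m + 3))) ?exprn_gt0 //.
rewrite [leRHS]mulrA -exprMn mulfV // expr1n mul1r.
rewrite mulr_sumr; case: H => [|[jm]]; apply: le_trans.
  rewrite /mass mulr_sumr; apply: ler_sum_nat => i /andP[_ iD].
  rewrite mulrCA [leRHS]mulrCA ler_wpM2l ?normc_ge0 //.
  apply: (le_trans (psum_evec_orbit _ iD)); case: ifP => // _.
  by rewrite divr_ge0 ?exprn_ge0 // ltW // wt_gt0.
apply: le_trans (psum_le_nrm (start m.+1) x); apply: le_trans (block_le_psum _ _).
apply: ler_sum_nat => i /andP[_ iD]; rewrite mulrCA ler_piMr ?normc_ge0 //.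
apply: (le_trans (psum_evec_orbit _ iD)); case: ltnP => // jiD.
by rewrite wt_top ?divff ?expf_neq0 //; lia.
Qed.

(** Summing over the later blocks; on unit vectors of the blocks up to [n] the
    remainder [x - trunc (start n.+1) x] vanishes. *)
Lemma influence n j (B : R) :
  0 <= B ->
  (forall m, (n < m)%N -> (mass m <= B) \/ ((j + ramp m < D m)%N /\ nrm x <= B)) ->
  psum (start n.+1) (iter j T (x - trunc (start n.+1) x)) <= B / 4.
Proof.
move=> B0 H; set S := start n.+1.
apply: (@seminorm_le _ (fun y => psum S (iter j T y)) (2 ^+ j)) => [y y'|l y|y|K].
- by rewrite (iterD_op HT) psumD.
- by rewrite (iterZ_op HT) psumZ.
- exact: (le_trans (psum_le_nrm _ _) (nrm_iter HT _ _)).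
have term0 k : 0 <= normc ((x - trunc S x) k) * psum S (iter j T (evec R k)).
  by rewrite mulr_ge0 ?normc_ge0 ?psum_ge0.
apply: (@le_trans _ _ (\sum_(0 <= k < start K)
    normc ((x - trunc S x) k) * psum S (iter j T (evec R k)))).
  rewrite [leRHS](big_cat_nat (n := K)) ?leq_id_start //= lerDl.
  exact: sumr_ge0.
rewrite sum_blocks; apply: (@le_trans _ _ (\sum_(0 <= m < K) 2^-1 ^+ m * (2^-1 ^+ 3 * B))).
  apply: ler_sum_nat => m _; rewrite mulrA -exprD.
  case: (ltnP n m) => nm; last first.
    rewrite big1_seq ?mulr_ge0 ?exprn_ge0 ?invr_ge0 // => i.
    rewrite mem_index_iota => /andP[_ /andP[_ iD]].
    rewrite coordB truncE ifT ?subrr ?normc0 ?mul0r // /S.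
    by apply: leq_trans (leq_start D (nm : m < n.+1)%N); rewrite startS ltn_add2l.
  apply: le_trans (block_influence (H _ nm)).
  apply: ler_sum_nat => i /andP[_ iD]; apply: ler_pM; rewrite ?normc_ge0 ?psum_ge0 //.
    rewrite coordB truncE ifF ?subr0 //.
    by apply/negbTE; rewrite -leqNgt /S (leq_trans (leq_start D nm)) // leq_addr.
  by apply: leq_psum; exact: leq_start.
rewrite -mulr_suml; apply: (@le_trans _ _ (2 * 2^-1 ^+ 0 * (2^-1 ^+ 3 * B))).
  by rewrite ler_wpM2r ?sum_half // mulr_ge0 ?exprn_ge0 ?invr_ge0.
rewrite expr0; lra.
Qed.

(** Here [i] and [i'] are the coordinates of a block that sit at a given place at a
    given time: there is at most one. *)
Lemma normc_sum_unique N (F : nat -> R[i]) :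
  (forall i i', (i < N)%N -> (i' < N)%N -> F i != 0 -> F i' != 0 -> i = i') ->
  normc (\sum_(0 <= i < N) F i) = \sum_(0 <= i < N) normc (F i).
Proof.
elim: N => [|N IH] H; first by rewrite !big_geq // normc0.
rewrite !big_nat_recr //=; have [FN|FN] := eqVneq (F N) 0.
  rewrite FN normc0 !addr0 IH // => i i' iN i'N; apply: H; exact: ltnW.
rewrite !big1_seq ?add0r // => i; rewrite mem_index_iota => /andP[_ /andP[_ iN]].
  have [->|Fi] := eqVneq (F i) 0; first by rewrite normc0.
  by have := H i N (ltnW iN) (leqnn _) Fi FN; lia.
have [//|Fi] := eqVneq (F i) 0.
by have := H i N (ltnW iN) (leqnn _) Fi FN; lia.
Qed.

(** The part of the mass of block [n] that sits on the ramp at time [j], without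
    the factor [2^ramp n]. *)
Definition ramp_mass n j : R :=
  \sum_(0 <= i < D n) ((j + i) %% D n < ramp n)%N%:R * (normc (x (start n + i)) / wt n i).

(** Inside its block a coordinate just moves cyclically, up to sign, and distinct
    coordinates never meet; beyond the ramp its size is its share of the mass. *)
Lemma block_lower n j :
  mass n <= 2 ^+ ramp n * ramp_mass n j +
    \sum_(0 <= r < D n) normc ((iter j T (trunc (start n.+1) x)) (start n + r)%N).
Proof.
have D0 := blocks_gt0 HD n.
have coordE r : (r < D n)%N -> normc ((iter j T (trunc (start n.+1) x)) (start n + r)%N) =
    \sum_(0 <= i < D n) if ((j + i) %% D n == r)%N then
      normc (x (start n + i)) / wt n i * wt n r else 0.
  move=> rD; pose F i := x (start n + i)%N * (iter j T (evec R (start n + i))) (start n + r)%N.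
  have FE i : (i < D n)%N -> F i = if ((j + i) %% D n == r)%N then
      x (start n + i)%N * (((wt n i)^-1)%:C * ((-1) ^+ ((j + i) %/ D n) * (wt n r)%:C)) else 0.
    move=> iD; rewrite /F evec_orbit // coordZ coordD !coordZ evecE eqn_add2l eq_sym.
    rewrite [X in _ + X](_ : _ = 0) ?addr0; last first.
      case: ifP => // _.
      exact: (@orbit_supported _ _ HD _ _ HT n _ _ (@feedback_supported _ _ _ _ HT n)) (leq_addr _ _).
    by case: eqP => [->|_]; rewrite ?mulr1 ?mulr0.
  rewrite {1}/trunc (iter_sum_op HT) (big_cat_nat (n := start n)) ?leq_start //= coordD.
  rewrite [X in X + _](_ : _ = 0) ?add0r; last first.
    rewrite coord_sum big1_seq // => k; rewrite mem_index_iota => /andP[_ /andP[_ kn]].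
    rewrite (iterZ_op HT) coordZ.
    by rewrite (@orbit_supported _ _ HD _ _ HT n _ _ (@supported_evec R _ _ kn)) ?mulr0 ?leq_addr.
  rewrite startS -{1}(add0n (start n)) big_addn addKn coord_sum.
  rewrite (eq_bigr F) => [|i _]; last by rewrite (iterZ_op HT) coordZ [(i + _)%N]addnC.
  rewrite normc_sum_unique => [|i i' iD i'D]; last first.
    rewrite !FE //; case: ifP => [/eqP <- _|]; last by rewrite eqxx.
    case: ifP => [+ _|]; last by rewrite eqxx.
    by rewrite eqn_modDl !modn_small // => /eqP ->.
  apply: eq_big_nat => i /andP[_ iD]; rewrite FE //; case: ifP => _; last by rewrite normc0.
  by rewrite !normcM normc_sign mul1r normc_wtV normc_wt mulrA.
rewrite (eq_big_nat _ _ (F2 := fun r => \sum_(0 <= i < D n) if ((j + i) %% D n == r)%N then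
      normc (x (start n + i)) / wt n i * wt n r else 0)) => [|r /andP[_ rD]]; last exact: coordE.
rewrite exchange_big /= /mass !mulr_sumr -big_split /=; apply: ler_sum => i _.
set c := _ / _; set rho := ((j + i) %% D n)%N.
have -> : \sum_(0 <= r < D n) (if rho == r then c * wt n r else 0) = c * wt n rho.
  rewrite -big_mkcond; under eq_bigl do rewrite eq_sym.
  by rewrite big_nat1_eq ltn_mod D0.
have c0 : 0 <= c by rewrite divr_ge0 ?normc_ge0 // ltW // wt_gt0.
case: ltnP => [_|/(wt_top R) ->]; rewrite ?mul1r.
  by rewrite lerDl mulr_ge0 // ltW // wt_gt0.
by rewrite mul0r mulr0 add0r mulrC.
Qed.

Lemma orbit_lower n j (B : R) :
  0 <= B ->
  (forall m, (n < m)%N -> (mass m <= B) \/ ((j + ramp m < D m)%N /\ nrm x <= B)) ->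
  mass n <= 2 ^+ ramp n * ramp_mass n j + nrm (iter j T x) + B / 4.
Proof.
move=> B0 H; apply: (le_trans (block_lower n j)); rewrite -addrA lerD2l.
set S := start n.+1.
apply: (@le_trans _ _ (\sum_(0 <= r < D n) normc ((iter j T x) (start n + r)%N) +
   \sum_(0 <= r < D n) normc ((iter j T (x - trunc S x)) (start n + r)%N))).
  rewrite -big_split; apply: ler_sum => r _ /=.
  have -> : iter j T (trunc S x) = iter j T x - iter j T (x - trunc S x).
    by rewrite (iterB_op HT) subKr.
  by rewrite coordB; apply: (le_trans (le_normcD _ _)); rewrite normcN.
apply: lerD.
  exact: (le_trans (block_le_psum _ _) (psum_le_nrm _ _)).
exact: (le_trans (block_le_psum _ _) (influence B0 H)).
Qed.

(** A vector whose blocks all have moderate mass from some point on is not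
    hypercyclic: the first blocks are power bounded and receive little. *)
Lemma coord0_bounded n (B : R) :
  (forall m, (n < m)%N -> mass m <= B) ->
  forall j, normc ((iter j T x) 0%N) <= 2 ^+ start n.+1 * nrm x + B / 4.
Proof.
move=> H j; have B0 : 0 <= B := le_trans (mass_ge0 _) (H _ (leqnn _)).
set S := start n.+1; have S0 : (0 < S)%N := leq_trans (ltn0Sn _) (leq_id_start HD _).
apply: (@le_trans _ _ (psum S (iter j T x))).
  rewrite /psum big_ltn // lerDl.
  by apply: sumr_ge0 => k _; exact: normc_ge0.
rewrite -{1}(subrK (trunc S x) x) addrC (iterD_op HT); apply: (le_trans (psumD _ _ _)).
apply: lerD; last by apply: influence => // m /H; left.
apply: (le_trans (psum_le_nrm _ _)).
apply: (le_trans (orbit_le HD HT _ (@trunc_supported _ _ _))).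
by rewrite ler_pM2l ?exprn_gt0 // nrm_trunc.
Qed.

End domination.
(** * Weighted counting *)

Section weights.
Variable R : realType.

Section residues.
Variables (L d : nat).
Hypotheses (L0 : (0 < L)%N) (dL : (d <= L)%N).

(** The number of [k < m] with [k %% L < d], in closed form. *)
Definition residue_count m := (m %/ L * d + minn (m %% L) d)%N.

Lemma residue_countS m :
  residue_count m.+1 = (residue_count m + (m %% L < d))%N.
Proof.
rewrite /residue_count; have rL := ltn_pmod m L0.
case: (ltnP (m %% L).+1 L) => rS.
  have -> : (m.+1 %/ L = m %/ L)%N.
    by rewrite {1}(divn_eq m L) -addnS divnMDl // (divn_small rS) addn0.
  have -> : (m.+1 %% L = (m %% L).+1)%N.
    by rewrite {1}(divn_eq m L) -addnS modnMDl (modn_small rS).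
  by rewrite -addnA; congr addn; lia.
have mE : (m.+1 = (m %/ L).+1 * L)%N by rewrite {1}(divn_eq m L); lia.
rewrite {1 2}mE mulnK // modnMl; lia.
Qed.

Lemma residue_count_bounds m :
  (d * m <= L * residue_count m <= d * m + L * d)%N.
Proof.
rewrite [X in (d * X)%N](divn_eq m L) /residue_count; have := ltn_pmod m L0.
move: (divn m L) (modn m L) => q r rL; rewrite /minn; case: ifP => rd; apply/andP; split; nia.
Qed.

(** The discrepancy [G m] between [L] times the number of good [k < m] and its
    mean value [d * m] stays between 0 and [L * d]; summation by parts against
    the non-decreasing weight then only leaves a multiple of the last term. *)
Lemma residue_weight (a : nat -> R) i N :
  (forall n, 0 <= a n) -> nondecreasing_seq a ->
  \sum_(0 <= j < N.+1) a j * ((j + i) %% L < d)%N%:R <=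
  d%:R / L%:R * \sum_(0 <= j < N.+1) a j + d%:R * a N.
Proof.
move=> a0 ai; pose G m : R := (L * residue_count m)%:R - (d * m)%:R.
have G0 m : 0 <= G m.
  by rewrite subr_ge0 ler_nat; have /andP[] := residue_count_bounds m.
have GL m : G m <= (L * d)%:R.
  by rewrite lerBlDl -natrD ler_nat; have /andP[] := residue_count_bounds m.
have GS m : G m.+1 = G m + (L%:R * (m %% L < d)%N%:R - d%:R).
  by rewrite /G residue_countS mulnDr mulnS !natrD !natrM; ring.
have L0' : 0 < L%:R :> R by rewrite ltr0n.
have key : \sum_(0 <= j < N.+1) a j * (L%:R * ((j + i) %% L < d)%N%:R - d%:R)
    <= a N * G (N + i).+1.
  elim: N => [|N IH]; first by rewrite big_nat1 GS ler_wpM2l // lerDr.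
  rewrite big_nat_recr //= GS [leRHS]mulrDr lerD2r; apply: (le_trans IH).
  by rewrite addSn ler_wpM2r // ai.
rewrite -(ler_pM2l L0'); set S := \sum_(0 <= j < N.+1) a j.
have -> : L%:R * (d%:R / L%:R * S + d%:R * a N) = d%:R * S + a N * (L * d)%:R.
  by rewrite natrM; field; rewrite gt_eqF.
rewrite -lerBlDl; apply: le_trans (ler_wpM2l (a0 N) (GL _)); apply: le_trans key.
rewrite !mulr_sumr -sumrB; apply: ler_sum => j _.
by rewrite mulrBr mulrCA [a j * d%:R]mulrC.
Qed.

End residues.

Lemma limn_esup_le (u : nat -> \bar R) (l : \bar R) N0 :
  (forall N, (N0 <= N)%N -> (u N <= l)%E) -> (limn_esup u <= l)%E.
Proof.
move=> H; rewrite limn_esup_lim; apply: lime_le; first exact: is_cvg_esups.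
exists N0 => // n /= N0n; apply: ge_ereal_sup => _ [k /= nk <-].
by apply: H; exact: leq_trans nk.
Qed.

(** Dividing [a N] by the partial sum before [N] gives [v_N(a)], which tends to 0;
    the sum is positive for large [N] because the weight is unbounded. *)
Lemma class_S_negligible (a : nat -> R) : class_S a -> forall d : nat, exists N0,
  forall N, (N0 <= N)%N ->
    0 < \sum_(0 <= j < N.+1) a j /\ d%:R * a N <= \sum_(0 <= j < N.+1) a j.
Proof.
case=> a0 ai /cvgryPgt/(_ 0)[N1 _ HN1] _ /cvgrPdist_lt Hv d.
have d0 : 0 < (d.+1%:R)^-1 :> R by rewrite invr_gt0.
have [N2 _ HN2] := Hv _ d0.
have S0 N : (N1 < N)%N -> 0 < \sum_(0 <= j < N) a j.
  move=> N1N; rewrite (big_cat_nat (n := N1)) ?(ltnW N1N) //= ltr_wpDl ?sumr_ge0 //.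
  by rewrite big_ltn // ltr_wpDr ?sumr_ge0 //; exact: HN1 (leqnn _).
exists (maxn N1.+1 N2) => N; rewrite geq_max => /andP[N1N N2N].
split; first exact/S0/ltnW.
have := HN2 _ N2N; rewrite /= sub0r normrN /v_seq ger0_norm; last first.
  by rewrite divr_ge0 // ltW // S0.
rewrite ltr_pdivrMr ?S0 // mulrC ltr_pdivlMr // => lt.
rewrite big_nat_recr //=; apply: (@le_trans _ _ (a N * d.+1%:R)).
  by rewrite mulrC ler_wpM2l // ler_nat.
by apply: ltW; apply: (lt_le_trans lt); rewrite lerDl.
Qed.

End weights.

(** * Visits to a small ball *)

Section visits.
Variables (R : realType) (a : nat -> R) (D : nat -> nat).
Hypotheses (a0 : forall n, 0 <= a n) (ai : nondecreasing_seq a).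
Hypothesis HD : block_lengths D.
Hypothesis sparse : forall n, (n.+1 * ramp D n <= D n)%N.
Hypothesis late : forall n N, (D n <= N + ramp D n)%N ->
  0 < \sum_(0 <= j < N.+1) a j /\
  (n.+1 * ramp D n)%:R * a N <= \sum_(0 <= j < N.+1) a j.
Local Notation ell1 := (ell1 R).
Local Notation ramp := (ramp D).
Variables (g : nat -> ell1) (T : ell1 -> ell1).
Hypothesis HT : block_operator D g T.
Variable x : ell1.
Local Notation mass := (mass D x).
Let theta := nrm x + 1.

Definition small_visits : set nat := [set j | nrm (iter j T x) < theta / 4].

(** Block [n] dominates up to time [N]. At a visit, the later blocks compensate
    at most a quarter of its mass and the vector in the ball at most another
    quarter, so half of the mass is on the ramp. Averaging this over the times
    leaves, coordinate by coordinate, a weight of residue classes. *)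
Lemma few_visits n N :
  theta <= mass n -> (D n <= N + ramp n)%N ->
  (forall m, (n < m)%N -> (mass m <= mass n) \/ (N + ramp m < D m)%N) ->
  \sum_(0 <= j < N.+1) a j * \1_small_visits j <=
  4 / n.+1%:R * \sum_(0 <= j < N.+1) a j.
Proof.
move=> tn DN dom; set S := \sum_(0 <= j < N.+1) a j.
have [S0 lateN] := late DN; rewrite -/S in S0 lateN.
have x_le : nrm x <= theta by rewrite lerDl.
have m0 : 0 < mass n by apply: lt_le_trans tn; rewrite ltr_wpDl // nrm_ge0.
have visit j : (j <= N)%N ->
    mass n * \1_small_visits j <= 2 * (2 ^+ ramp n * ramp_mass D x n j).
  move=> jN; rewrite indicE; case: (boolP (j \in small_visits)) => [/set_mem jA|_]; last first.
    rewrite mulr0 mulr_ge0 // mulr_ge0 ?exprn_ge0 // sumr_ge0 // => i _.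
    by rewrite mulr_ge0 // divr_ge0 ?normc_ge0 // ltW // wt_gt0.
  have cond m : (n < m)%N ->
      mass m <= mass n \/ (j + ramp m < D m)%N /\ nrm x <= mass n.
    move=> /dom[|Nm]; [by left|right]; split; last exact: le_trans tn.
    by apply: leq_ltn_trans Nm; rewrite leq_add2r.
  have := orbit_lower HD HT (ltW m0) cond.
  rewrite /small_visits /= in jA; rewrite mulr1; by move: tn jA; set u := theta; lra.
have n1 : 0 < n.+1%:R :> R by rewrite ltr0n.
have share i : \sum_(0 <= j < N.+1) a j * ((j + i) %% D n < ramp n)%N%:R <=
    2 / n.+1%:R * S.
  apply: le_trans (residue_weight (blocks_gt0 HD n) (ltnW (ramp_lt HD n)) i N a0 ai) _.
  rewrite -/S mulrDl mul1r [leRHS]mulrDl; apply: lerD.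
    rewrite ler_pM2r // ler_pdivrMr ?ltr0n ?(blocks_gt0 HD) // mulrC.
    by rewrite ler_pdivlMr // -natrM ler_nat mulnC.
  by rewrite [leRHS]mulrC ler_pdivlMr // mulrC mulrA -natrM.
rewrite -(ler_pM2l m0) mulr_sumr.
apply: (@le_trans _ _ (\sum_(0 <= j < N.+1) a j * (2 * (2 ^+ ramp n * ramp_mass D x n j)))).
  apply: ler_sum_nat => j /andP[_ jN]; rewrite mulrCA.
  by apply: ler_wpM2l => //; exact: visit.
rewrite (_ : \sum_(0 <= j < N.+1) _ = 2 * (2 ^+ ramp n * \sum_(0 <= i < D n)
    normc (x (start D n + i)) / wt R D n i *
    \sum_(0 <= j < N.+1) a j * ((j + i) %% D n < ramp n)%N%:R)); last first.
  under [in RHS]eq_bigr do rewrite mulr_sumr.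
  rewrite [in RHS]exchange_big /= !mulr_sumr; apply: eq_bigr => j _.
  rewrite mulrCA; congr (_ * _); rewrite mulrCA; congr (_ * _).
  rewrite /ramp_mass mulr_sumr; apply: eq_bigr => i _.
  by rewrite [RHS]mulrC -[RHS]mulrA.
apply: (@le_trans _ _ (2 * (mass n * (2 / n.+1%:R * S)))).
  rewrite ler_pM2l // /mass -[leRHS]mulrA ler_pM2l ?exprn_gt0 // mulr_suml.
  apply: ler_sum => i _; apply: ler_wpM2l (share i).
  by rewrite divr_ge0 ?normc_ge0 // ltW // wt_gt0.
rewrite le_eqVlt; apply/orP; left; apply/eqP.
by move: n1; move: n.+1%:R => u u0; field; rewrite gt_eqF.
Qed.

(** The dominating block depends on [N], but it can be taken after any given
    [n0]: this is where infinitely many heavy blocks are required. *)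
Lemma visits_density : (forall n0, exists2 n, (n0 < n)%N & theta <= mass n) ->
  (upper_density a small_visits <= 0)%E.
Proof.
move=> inf; apply/lee_addgt0Pr => e e0; rewrite add0e.
have [n0 n0e] : exists n0 : nat, 4 / n0.+1%:R <= e.
  exists (Num.bound (4 / e)); rewrite ler_pdivrMr // mulrC -ler_pdivrMr //.
  apply: ltW; apply: lt_trans (archi_boundP _) _; first by rewrite divr_ge0 // ltW.
  by rewrite ltr_nat.
have [n1 n01 tn1] := inf n0.
have ramp_gt m : (m < D m)%N.
  by apply: leq_ltn_trans (ramp_lt HD m); rewrite /ramp /lag; lia.
apply: (@limn_esup_le _ _ _ (D n1)) => N DN; rewrite lee_fin.
(* A block with [D m <= N + ramp m] has index at most [N]. *)
pose P (i : 'I_N.+1) := (n0 <= i)%N && (D i <= N + ramp i)%N.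
have n1N : (n1 < N.+1)%N by have := ramp_gt n1; lia.
have Pn1 : P (Ordinal n1N).
  by rewrite /P /= ltnW //= (leq_trans DN) // leq_addr.
case: (@Order.TotalTheory.arg_maxP _ _ _ (Ordinal n1N) P (fun i => mass i) Pn1).
move=> n /andP[n0n Dn] max_n.
have tn : theta <= mass n by apply: (le_trans tn1); exact: max_n Pn1.
have [S0 _] := late Dn.
rewrite ler_pdivrMr //; apply: le_trans (few_visits tn Dn _) _ => [m nm|]; last first.
  rewrite ler_pM2r //; apply: le_trans n0e.
  by rewrite ler_pM2l // lef_pV2 ?posrE // ler_nat.
case: (leqP (D m) (N + ramp m)) => [Dm|]; last by right.
left; have mN : (m < N.+1)%N.
  have := sparse m; have : (0 < ramp m)%N by rewrite /ramp /lag; lia.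
  nia.
by apply: (max_n (Ordinal mN)); rewrite /P /= Dm andbT; lia.
Qed.

End visits.
(** * Choice of the parameters *)

Section parameters.
Variable h : nat -> nat.

(** The state before block [n]: where it starts, and the previous length, with 1
    in place of the length before block 0. *)
Fixpoint block_state n : nat * nat :=
  if n is m.+1 then
    let: (s, p) := block_state m in
    let d := (2 * (s + 2 * m + 4))%N in
    let l := (2 * p * (m.+1 * d + d + h (m.+1 * d)).+1)%N in
    (s + l, l)%N
  else (0, 1)%N.

(** The bound [h] is applied to [n.+1 * ramp n], which depends on the earlier
    lengths only, so the recursion is well founded. *)
Lemma exists_block_lengths : exists D, block_lengths D /\ forall n,
  (n.+1 * ramp D n <= D n)%N /\ (h (n.+1 * ramp D n) + ramp D n <= D n)%N.
Proof.
pose D n := (block_state n.+1).2; exists D.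
have startE n : (block_state n).1 = start D n.
  elim: n => [|n IH]; first by rewrite /start big_geq.
  by rewrite startS -IH /D /=; case: (block_state n).
have prev_gt0 n : (0 < (block_state n).2)%N.
  by elim: n => //= n; case: (block_state n) => s p /= p0; rewrite !muln_gt0 p0.
have DE n : D n = (2 * (block_state n).2 *
    (n.+1 * ramp D n + ramp D n + h (n.+1 * ramp D n)).+1)%N.
  rewrite {1}/D /= /ramp /lag -startE; by case: (block_state n).
have Dge n : (n.+1 * ramp D n + ramp D n + h (n.+1 * ramp D n) < D n)%N.
  by rewrite [X in (_ < X)%N]DE -[X in (X <= _)%N]mul1n leq_mul // muln_gt0 prev_gt0.
split; first split => n.
- by have := Dge n; lia.
- by rewrite [X in (_ %| X)%N]DE dvdn_mulr.
- by move=> n; have := Dge n; split; lia.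
Qed.

End parameters.

(** * Construction of the operator *)

Section construction.
Variables (R : realType) (D : nat -> nat).
Hypothesis HD : block_lengths D.
Local Notation ell1 := (ell1 R).
Variable g : nat -> ell1.
Hypothesis g_supp : forall n, supported (start D n) (g n).
Hypothesis g_le : forall n, nrm (g n) <= 2 ^+ (lag D n + n.+1).

Definition column k : ell1 :=
  let: (n, i) := block_pos D k in
  ((wt R D n i)^-1)%:C *:
    (if (i.+1 < D n)%N then fvec R D n i.+1 else g n - fvec R D n 0).

Lemma nrm_column k : nrm (column k) <= 2.
Proof.
elim/(block_ind HD): k => n i iD; rewrite /column block_posE //.
rewrite nrmZ normc_wtV ler_pdivrMl ?wt_gt0 //; case: ltnP => iS.
  rewrite nrm_fvec mulrC -exprS ler_weXn2l ?ler1n //; lia.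
have := ramp_lt HD n => rD; rewrite wt_top; last lia.
apply: (le_trans (nrmB _ _)); rewrite nrm_fvec mulr_natr mulr2n; apply: lerD; last exact: wt_le.
by apply: (le_trans (g_le n)); rewrite ler_weXn2l ?ler1n // /ramp /lag; lia.
Qed.

Lemma exists_block_operator : exists T, block_operator D g T.
Proof.
have [T [Tlin Tle Te]] := operator_of_columns (ler0n R 2) nrm_column.
have T0 : T 0 = 0.
  by have := Tlin (-1) 0 0; rewrite scaler0 addr0 scaleN1r addNr.
have Tf n i : (i < D n)%N -> T (fvec R D n i) =
    if (i.+1 < D n)%N then fvec R D n i.+1 else g n - fvec R D n 0.
  move=> iD; have := Tlin (wt R D n i)%:C (evec R (start D n + i)) 0.
  rewrite T0 !addr0 Te /column block_posE // scalerA -rmorphM /= mulfV ?wt_neq0 //.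
  by rewrite scale1r.
have D0 := blocks_gt0 HD.
exists T; split => // [n i iD|n]; first by rewrite Tf ?iD // ltnW.
by rewrite Tf prednK // ltnn.
Qed.

End construction.

(** * The theorem *)

Section not_frequent.
Variables (R : realType) (a : nat -> R) (D : nat -> nat).
Hypotheses (a0 : forall n, 0 <= a n) (ai : nondecreasing_seq a).
Hypothesis HD : block_lengths D.
Hypothesis sparse : forall n, (n.+1 * ramp D n <= D n)%N.
Hypothesis late : forall n N, (D n <= N + ramp D n)%N ->
  0 < \sum_(0 <= j < N.+1) a j /\
  (n.+1 * ramp D n)%:R * a N <= \sum_(0 <= j < N.+1) a j.
Variables (g : nat -> ell1 R) (T : ell1 R -> ell1 R).
Hypothesis HT : block_operator D g T.

(** The ball around zero depends on [x]; when the masses are moderate another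
    ball is missed altogether. *)
Lemma not_U_frequently_hypercyclic : ~ U_frequently_hypercyclic a T.
Proof.
case=> x Hx; pose theta := nrm x + 1.
have theta0 : 0 < theta by rewrite ltr_wpDl // nrm_ge0.
have [[n0 bdd]|unb] := pselect (exists n0, forall n, (n0 < n)%N -> mass D x n <= theta).
  have C0 := coord0_bounded HD HT bdd; move: C0; set C := _ + _ => C0.
  (* The first coordinate stays bounded along the orbit, which therefore misses
     a ball entirely. *)
  pose c : ell1 R := (C + 1)%:C *: evec R 0.
  have := Hx (ball c (1 : R[i])) (ball_open _ _) (ex_intro _ _ (ballxx _ ltr01)).
  rewrite (_ : [set n | _] = set0); last first.
    rewrite -subset0 => j /=; rewrite -ball_normE /= normE ltcR => far.
    have := le_lt_trans (psum_le_nrm 1 _) far.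
    rewrite /psum big_nat1 coordB coordZ evecE eqxx mulr1 => lt1.
    have C1 : 0 <= C + 1 by rewrite addr_ge0 // (le_trans (normc_ge0 _) (C0 0%N)).
    have := le_normcD ((C + 1)%:C - iter j T x 0%N) (iter j T x 0%N).
    rewrite subrK normc_real ger0_norm //; have := C0 j; lra.
  rewrite ltNge => /negP; apply; apply: (@limn_esup_le _ _ _ 0) => N _.
  by rewrite big1 ?mul0r // => j _; rewrite indicE in_set0 mulr0.
pose U : set (ell1 R) := ball (0 : ell1 R) (theta / 4)%:C.
have r0 : 0 < (theta / 4)%:C :> R[i] by rewrite ltcR divr_gt0.
have := Hx U (ball_open _ _) (ex_intro _ _ (ballxx _ r0)).
have -> : [set n | U (iter n T x)] = small_visits T x.
  by apply/seteqP; split => n; rewrite /U -ball_normE /= sub0r normrN normE ltcR.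
rewrite ltNge => /negP; apply.
apply: (visits_density a0 ai HD sparse late HT) => n0.
move/forallNP : unb => /(_ n0)/existsNP[n /not_implyP[n0n /negP]].
by rewrite -ltNge => /ltW; exists n.
Qed.

End not_frequent.

Theorem theorem3p7 (R : realType) (a : nat -> R) (ha : class_S a) :
  exists T : ell1 R -> ell1 R,
    [/\ bounded_operator T, chaotic T & ~ U_frequently_hypercyclic a T].
Proof.
have [a0 ai _ _ _] := ha.
have [h Hh] := choice (class_S_negligible ha).
have [D [HD sparse]] := exists_block_lengths h.
have [z [z_supp z_le z_dense]] := dense_targets R (leq_id_start HD).
have g_supp n : supported (start D n) (feedback HD z n).
  apply: supportedZ; apply: supportedD => //; apply: supportedN.
  exact: trunc_supported.
have [T HT] := exists_block_operator HD g_supp (fun n => feedback_nrm HD (z_le n)).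
exists T; split.
- split; first exact: (op_linear HT).
  exists 2 => x; rewrite !normE.
  have -> : 2 = (2 : R)%:C by rewrite rmorph_nat.
  by rewrite -rmorphM lecR (op_bounded HT).
- by split; [exact: (hvec_hypercyclic HT z_dense) | exact: (periodic_dense HD HT)].
- apply: (not_U_frequently_hypercyclic a0 ai HD (fun n => (sparse n).1) _ HT) => n N DN.
  by apply: Hh; have := (sparse n).2; lia.
Qed.
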